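(* Suppose $a=\{a_j\}_{j\ge1}$ is a positive, decreasing, summable sequence and that $\sup_{j\ge1} s_j/s_{j-1}<1/2$, where $s_n=2^{-n}\sum_{j=2^n}^\infty a_j$ for $n\ge0$. Then $$\{\dim_L E: E\in\mathcal{C}_a\}=[0,\dim_L C_a].$$
   Context: Decreasing means $a_j\ge a_{j+1}$ for all $j$. Let $L=\sum_j a_j$. The family $\mathcal{C}_a$ of complementary sets of $a$ consists of the closed subsets $E$ of $[0,L]$ of the form $E=[0,L]\setminus\bigcup_{j=1}^\infty U_j$, where $\{U_j\}$ is a disjoint family of open intervals contained in $[0,L]$ with the length of $U_j$ equal to $a_j$ for each $j$. The associated Cantor set $C_a\in\mathcal{C}_a$ is constructed as follows. From $I=[0,L]$ remove an open interval of length $a_1$, leaving two closed intervals $I^1_1$ and $I^1_2$ (left to right). Having constructed the closed intervals $I^k_1,\dots,I^k_{2^k}$ of step $k$ (left to right), remove from each $I^k_j$ an open interval of length $a_{2^k+j-1}$, leaving the closed intervals $I^{k+1}_{2j-1}$ and $I^{k+1}_{2j}$. The positions are uniquely determined by requiring that the length of each $I^k_j$ equal the sum of the lengths of all the open intervals subsequently removed from it. Then $C_a=\bigcap_{k\ge1}\bigcup_{j=1}^{2^k}I^k_j$. For non-empty $F\subset\mathbb{R}$, $N_r(F)$ denotes the minimum number of closed balls of radius $r$ needed to cover $F$, and $B(x,R)$ is the closed ball of radius $R$ centred at $x$. The Lower Assouad dimension is $$\dim_L F=\sup\Bigl\{\alpha:\ \exists\, c,\rho>0 \text{ such that } \inf_{x\in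 F}N_r(B(x,R)\cap F)\ge c\left(\tfrac{R}{r}\right)^{\alpha}\text{ for all }0<r<R<\rho\Bigr\}.$$ *)

(* Defs.v *)
(* MathComp-Analysis *)
From mathcomp Require Export all_boot all_order all_algebra.
From mathcomp Require Export all_classical all_reals all_analysis.
Import Order.TTheory GRing.Theory Num.Theory.
Import numFieldNormedType.Exports.

Set Implicit Arguments.
Unset Strict Implicit.
Unset Printing Implicit Defensive.

Local Open Scope classical_set_scope.
Local Open Scope ring_scope.

(* A sequence (a_j)_{j >= 1} is encoded as a : nat -> R; the value a 0 is never
   used. *)

Definition gap_summable (R : realType) (a : nat -> R) : Prop :=
  cvgn (fun n => \sum_(1 <= j < n) a j).

Definition total_length (R : realType) (a : nat -> R) : R :=
  \big[+%R/0]_(1 <= j <oo) a j.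

(* The open interval of length a_j is written ]u_j, u_j + a_j[. *)
Definition complementary_sets (R : realType) (a : nat -> R) : set (set R) :=
  [set E | closed E /\
    exists u : nat -> R,
      let U := fun j => `]u j, u j + a j[%classic in
      let I := `[0, total_length a]%classic in
      [/\ trivIset [set j | (1 <= j)%N] U,
          forall j, (1 <= j)%N -> U j `<=` I
        & E = I `\` \bigcup_(j in [set j | (1 <= j)%N]) U j]].

(* The length of I^k_j, i.e. the sum of all gaps subsequently removed from it.
   At step k + i the descendants of I^k_j are the I^{k+i}_{m+1} with
   (j - 1) 2^i <= m < j 2^i, and the gap removed from I^{k+i}_{m+1} has index
   2^{k+i} + m. *)
Definition cantor_length (R : realType) (a : nat -> R) (k j : nat) : R :=
  \big[+%R/0]_(0 <= i <oo) \sum_(j.-1 * 2 ^ i <= m < j * 2 ^ i) a (2 ^ (k + i) + m)%N.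

(* The left endpoint of I^k_j, with I^0_1 = [0, L].  The parent of I^{k+1}_j is
   I^k_p with p = uphalf j; an odd j is the left child, and an even j is the
   right child, which comes after I^{k+1}_{j-1} and the gap a_{2^k+p-1}. *)
Fixpoint cantor_left (R : realType) (a : nat -> R) (k j : nat) : R :=
  if k is k'.+1 then
    let p := uphalf j in
    cantor_left a k' p +
      (if odd j then 0
       else cantor_length a k'.+1 j.-1 + a (2 ^ k' + p - 1)%N)
  else 0.

Definition cantor_interval (R : realType) (a : nat -> R) (k j : nat) : set R :=
  `[cantor_left a k j, cantor_left a k j + cantor_length a k j]%classic.

Definition cantor_set (R : realType) (a : nat -> R) : set R :=
  \bigcap_(k in [set k | (1 <= k)%N])
    \bigcup_(j in [set j | (1 <= j <= 2 ^ k)%N]) cantor_interval a k j.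

(* N_r(F), equal to +oo if no finite family of balls of radius r covers F. *)
Definition covering_number (R : realType) (r : R) (F : set R) : \bar R :=
  ereal_inf [set (n%:R)%:E | n in
    [set n : nat | exists x : 'I_n -> R, F `<=` \bigcup_i closed_ball (x i) r]].

(* d is the large radius. *)
Definition lower_assouad_dim (R : realType) (F : set R) : \bar R :=
  ereal_sup [set alpha%:E | alpha in
    [set alpha : R | exists c rho : R,
      [/\ 0 < c, 0 < rho &
        forall r d : R, 0 < r -> r < d -> d < rho ->
          ((c * (d / r) `^ alpha)%:E <=
             ereal_inf [set covering_number r (closed_ball x d `&` F)
                       | x in F])%E]]].

Definition dyadic_mean (R : realType) (a : nat -> R) (n : nat) : R :=
  (2 ^+ n)^-1 * \big[+%R/0]_(2 ^ n <= j <oo) a j.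

(* Main.v *)
Require Import Defs.
From mathcomp Require Import ring lra zify.
Import Order.TTheory GRing.Theory Num.Theory.
Import numFieldNormedType.Exports.

Set Implicit Arguments.
Unset Strict Implicit.
Unset Printing Implicit Defensive.

Local Open Scope classical_set_scope.
Local Open Scope ring_scope.

(** Let [s n] be the dyadic means. The hypothesis says that they shrink at each step
    by a factor below a constant less than 1/2, so that the gap [a (2 ^ n)] is at
    least a fixed multiple of [s n], while all gaps from [2 ^ n] on have total length
    [2 ^ n * s n].

    Both directions go through one condition on an exponent [alpha], here
    [slow_decay]: [(s n / s (n + k)) ^ alpha <= C * 2 ^ k] for all [n] and [k].

    - Any complementary set with lower exponent [alpha >= 0] forces it
      ([exponent_slow_decay]). The set is covered by about [2 ^ (n + k)] balls of
      radius [s (n + k)] ([gap_cover]), while the left ends of the first [2 ^ n]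
      gaps are separated by a multiple of [s n]; hence on average the ball of
      radius about [s n] around such an end uses [2 ^ k] of the small balls.

    - Conversely it makes [alpha > 0] a lower exponent of the Cantor set
      ([cantor_exponent]): a point lies in a node of depth [n] of the tree of gaps,
      of diameter about [s n], and the gaps of depth [n + k] below that node
      separate [2 ^ k] points.

    So the dimension of the Cantor set is an upper bound, and it remains to realise
    every smaller [x]. Complementary sets are produced by choosing an order of the
    gaps: [arrangement a key] places the gap [j] after all gaps with a smaller key.
    The Cantor set is the arrangement along the infix order of the binary tree
    ([cantor_set_arrangement]), and the natural order of the indices isolates the
    point 0 and gives dimension 0 ([sorted_arrangement_dim]).

    For [0 < x < alpha] with [alpha] a lower exponent of the Cantor set, choose for
    each depth [i] a level [phi i] with [s (phi i)] comparable to [2 ^ (- i / x)].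
    By slow decay [phi i >= i + 2], so level [phi i] contains more than enough gaps
    to pick [2 ^ i] of them with odd index. The picked gaps build a Cantor set
    of box dimension [x] at the left ([sparse_box_cover]); the other gaps follow, in
    the tree order, with the picked ones left out. The even indices are all still
    there, and they suffice for the lower bound. The lower bound on both parts is
    [part_lower_bound], applied to the two trees of gaps; the left part shows that
    the exponent cannot exceed [x] ([mixed_dim]). *)

(** * Sums over sets of gaps *)

(** The total length of the gaps with index in [A]. All positions are expressed by
    such sums, so that comparing positions amounts to comparing sets of gaps. *)
Definition weight (R : realType) (a : nat -> R) (A : pred nat) : R :=
  \big[+%R/0]_(1 <= j <oo | A j) a j.

Section Weight.
Context {R : realType} (a : nat -> R).
Hypothesis a_ge0 : forall j, (1 <= j)%N -> 0 <= a j.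
Hypothesis a_sum : gap_summable a.
Implicit Types A B Z : pred nat.

Lemma partial_weight_mono A B m n : (m <= n)%N ->
  (forall j, (1 <= j)%N -> A j -> B j) ->
  \sum_(1 <= j < m | A j) a j <= \sum_(1 <= j < n | B j) a j.
Proof.
move=> mn AB; apply: (@le_trans _ _ (\sum_(1 <= j < m | B j) a j)).
  rewrite big_mkcond [leRHS]big_mkcond /= !big_nat; apply: ler_sum => j /andP[j1 _].
  case: ifP => [/AB->//|_]; case: ifP => // _; exact: a_ge0.
case: m mn => [|m] mn.
  by rewrite big_geq// big_nat_cond; apply: sumr_ge0 => j /andP[/andP[? _] _]; exact: a_ge0.
rewrite (@big_cat_nat _ _ _ m.+1 1 n) //= lerDl big_nat_cond; apply: sumr_ge0 => j.
by move=> /andP[/andP[mj _] _]; apply: a_ge0; apply: leq_trans mj.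
Qed.

Lemma partial_weight_cvg A : cvgn (fun n => \sum_(1 <= j < n | A j) a j).
Proof.
apply: nondecreasing_is_cvgn => [m n mn|]; first exact: partial_weight_mono.
exists (total_length a) => _ [n _ <-].
apply: (@le_trans _ _ (\sum_(1 <= j < n) a j)); first exact: partial_weight_mono.
apply: (@nondecreasing_cvgn_le _ (fun n => \sum_(1 <= j < n) a j)) => // i j ij.
exact: partial_weight_mono.
Qed.

Lemma partial_weight_le A n : \sum_(1 <= j < n | A j) a j <= weight a A.
Proof.
apply: (@nondecreasing_cvgn_le _ (fun n => \sum_(1 <= j < n | A j) a j)).
  by move=> i j ij; exact: partial_weight_mono.
exact: partial_weight_cvg.
Qed.

Lemma weight_le A b : (forall n, \sum_(1 <= j < n | A j) a j <= b) -> weight a A <= b.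
Proof.
move=> h; apply: limr_le; first exact: partial_weight_cvg.
by apply: nearW => n; exact: h.
Qed.

Lemma weight_mono A B : (forall j, (1 <= j)%N -> A j -> B j) -> weight a A <= weight a B.
Proof.
move=> AB; apply: weight_le => n; apply: le_trans (partial_weight_le B n).
exact: partial_weight_mono.
Qed.

Lemma eq_weight A B : (forall j, (1 <= j)%N -> A j = B j) -> weight a A = weight a B.
Proof. by move=> AB; apply/le_anti/andP; split; apply: weight_mono => j /AB->. Qed.

Lemma weight_ge0 A : 0 <= weight a A.
Proof. by have := partial_weight_le A 0; rewrite big_geq. Qed.

Lemma weightT : weight a xpredT = total_length a.
Proof. by []. Qed.

Lemma weightID B A :
  weight a A = weight a (fun j => A j && B j) + weight a (fun j => A j && ~~ B j).
Proof.
rewrite /weight -limD; [|exact: partial_weight_cvg..].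
by congr (limn _); apply/funext => n /=; rewrite (bigID B).
Qed.

Lemma weightU A B Z :
  (forall j, (1 <= j)%N -> A j -> B j || Z j) -> weight a A <= weight a B + weight a Z.
Proof.
move=> h; rewrite (weightID B); apply: lerD; apply: weight_mono => j j1 /andP[] //.
by move=> /(h _ j1) /orP[->|].
Qed.

Lemma weight_disjointU A B Z :
    (forall j, (1 <= j)%N -> A j = B j || Z j) ->
    (forall j, (1 <= j)%N -> ~~ (B j && Z j)) ->
  weight a A = weight a B + weight a Z.
Proof.
move=> h hd; rewrite (weightID B); congr (_ + _); apply: eq_weight => j j1.
  by rewrite h//; case: (B j); case: (Z j).
by rewrite h//; have := hd j j1; case: (B j); case: (Z j).
Qed.

Lemma weight_dist A B Z :
    (forall j, (1 <= j)%N -> A j != B j -> Z j) ->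
  `|weight a A - weight a B| <= weight a Z.
Proof.
move=> h; rewrite ler_norml; apply/andP; split.
  rewrite lerBrDl lerBlDr; apply: weightU => j j1 Bj.
  by case Aj: (A j) => //=; apply: h => //; rewrite Aj Bj.
rewrite lerBlDl; apply: weightU => j j1 Aj.
by case Bj: (B j) => //=; apply: h => //; rewrite Aj Bj.
Qed.

Lemma weight1 i : (1 <= i)%N -> weight a (pred1 i) = a i.
Proof.
move=> i1; have e n : (i < n)%N -> \sum_(1 <= j < n | pred1 i j) a j = a i.
  move=> ni; rewrite big_mkcond (bigD1_seq i) /= ?eqxx ?iota_uniq ?mem_index_iota ?i1//.
  by rewrite big1 ?addr0// => j /negbTE ->.
apply/le_anti/andP; split; last by rewrite -(e i.+1)//; exact: partial_weight_le.
apply: weight_le => n; rewrite -(e (maxn n i.+1)) ?leq_max ?leqnn ?orbT//.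
by apply: partial_weight_mono => //; rewrite leq_maxl.
Qed.

Lemma tail_weight m : (1 <= m)%N ->
  \big[+%R/0]_(m <= j <oo) a j = weight a (fun j => (m <= j)%N).
Proof.
move=> m1; rewrite /weight; congr (limn _); apply/funext => n /=.
by rewrite (@big_nat_widenl _ _ _ m 1 n).
Qed.

Lemma head_weight A m :
  weight a (fun j => A j && (j < m)%N) = \sum_(1 <= j < m | A j) a j.
Proof.
have e n : \sum_(1 <= j < m + n | A j && (j < m)%N) a j = \sum_(1 <= j < m | A j) a j.
  by rewrite (@big_nat_widen _ _ _ 1 m (m + n)) // leq_addr.
apply/le_anti/andP; split; last first.
  rewrite -(e 0%N); exact: (partial_weight_le (fun j => A j && (j < m)%N)).
apply: weight_le => n; rewrite -(e n); apply: partial_weight_mono => //; exact: leq_addl.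
Qed.

End Weight.

Lemma weight_cover (R : realType) (a : nat -> R) (A : pred nat) (I : Type) (r : seq I)
    (B : I -> pred nat) :
  (forall j, (1 <= j)%N -> 0 <= a j) -> gap_summable a ->
  (forall j, (1 <= j)%N -> A j -> has (B^~ j) r) ->
  weight a A <= \sum_(i <- r) weight a (B i).
Proof.
move=> a0 asum; elim: r A => [|i r IH] A cov.
  rewrite big_nil; apply: weight_le => // n; rewrite big_nat_cond big1// => j.
  by move=> /andP[/andP[j1 _] /(cov j j1)].
rewrite big_cons; apply: le_trans (weightU a0 asum (B := B i) (Z := fun j => A j && ~~ B i j) _) _.
  by move=> j j1 ->; case: (B i j).
rewrite lerD2l; apply: IH => j j1 /andP[Aj nB].
by have := cov j j1 Aj; rewrite /= (negbTE nB).
Qed.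

(** * Covering numbers *)

Section Covering.
Context {R : realType}.
Implicit Types (F : set R) (s : seq R).

Lemma covering_number_le F r s : 0 < r ->
    (forall y, F y -> exists2 c, c \in s & `|c - y| <= r) ->
  (covering_number r F <= ((size s)%:R)%:E)%E.
Proof.
move=> r0 h; apply: ereal_inf_lbound; exists (size s) => //.
exists (fun i => s`_i) => y /h[c cs cy].
have := cs; rewrite -index_mem => ics; exists (Ordinal ics) => //=.
by rewrite nth_index// closed_ballE.
Qed.

(** A closed ball of radius [r] contains at most one of the points. *)
Lemma covering_number_ge_card F r m (f : 'I_m -> R) : 0 < r ->
    (forall i, F (f i)) -> (forall i j, i != j -> 2 * r < `|f i - f j|) ->
  ((m%:R)%:E <= covering_number r F)%E.
Proof.
move=> r0 Ff sepf; apply/ereal_infP => _ [n [x cov] <-].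
have /choice[g gP] : forall i, exists k, `|x k - f i| <= r.
  by move=> i; have [k _] := cov _ (Ff i); rewrite closed_ballE//; exists k.
rewrite lee_fin ler_nat; suff inj : injective g by rewrite -(card_ord m) -(card_ord n) (leq_card g inj).
move=> i j gij; apply/eqP; apply: contraT => /sepf.
have := ler_distD (x (g i)) (f i) (f j); have := gP i; have := gP j.
by rewrite -gij (distrC (x _) (f i)); lra.
Qed.

Lemma covering_number_ge1 F r y : 0 < r -> F y -> (1%:E <= covering_number r F)%E.
Proof.
move=> r0 Fy; apply: (@covering_number_ge_card F r 1 (fun=> y)) => // i j.
by rewrite !ord1 eqxx.
Qed.

Lemma interval_cover (p q r : R) : p <= q -> 0 < r ->
  exists2 s, (size s)%:R <= 1 + (q - p) / r &
    forall y, p <= y <= q -> exists2 c, c \in s & `|c - y| <= r.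
Proof.
move=> pq r0; have pqr : 0 <= (q - p) / r by apply: divr_ge0; lra.
exists [seq p + k%:R * r | k <- iota 0 (Num.truncn ((q - p) / r)).+1].
  rewrite size_map size_iota -addn1 natrD addrC lerD2l truncn_le//.
move=> y /andP[py yq]; set k := Num.truncn ((y - p) / r).
have yr : 0 <= (y - p) / r by apply: divr_ge0; lra.
exists (p + k%:R * r).
  apply/mapP; exists k => //; rewrite mem_iota /= add0n ltnS; apply: le_truncn.
  by rewrite ler_pM2r ?invr_gt0//; lra.
have /andP[] := truncn_itv yr; rewrite -/k ler_pdivlMr// ltr_pdivrMr//.
by rewrite -natr1 mulrDl ler_norml => ? ?; apply/andP; split; lra.
Qed.

(** Removing one gap splits the interval, and every other gap lies on one side of
    it; the bound is additive over the two sides. *)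
Lemma gap_cover (u a : nat -> R) (r : R) (J : seq nat) (p q : R) : 0 < r ->
    uniq J -> p <= q ->
    (forall j, j \in J -> [/\ 0 < a j, p <= u j & u j + a j <= q]) ->
    {in J &, forall i j, i != j -> u i + a i <= u j \/ u j + a j <= u i} ->
  exists2 s, (size s)%:R <= (size J).+1%:R + (q - p - \sum_(j <- J) a j) / r &
    forall y, p <= y <= q -> (forall j, j \in J -> ~~ (u j < y < u j + a j)) ->
      exists2 c, c \in s & `|c - y| <= r.
Proof.
move=> r0; have [n] := ubnP (size J); elim: n J p q => // n IH [|j J] p q.
  move=> _ _ pq _ _; have [s ss hs] := interval_cover pq r0; exists s.
    by rewrite big_nil subr0.
  by move=> y /hs.
rewrite /= !ltnS => sJ /andP[jJ uJ] pq inpq sepJ.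
have [aj puj ujq] := inpq j (mem_head _ _).
pose left_of : pred nat := fun i => u i < u j.
have sub i : i \in J -> i \in j :: J by rewrite inE orbC => ->.
have side i : i \in J -> if left_of i then u i + a i <= u j else u j + a j <= u i.
  move=> iJ; have [ai _ _] := inpq i (sub i iJ).
  have ij : i != j by apply: contraNneq jJ => <-.
  have [] := sepJ i j (sub i iJ) (mem_head _ _) ij; rewrite /left_of /=; case: ltP => //; lra.
have [s1 ss1 hs1] : exists2 s, (size s)%:R <= (size (seq.filter left_of J)).+1%:R +
    (u j - p - \sum_(j <- seq.filter left_of J) a j) / r &
    forall y, p <= y <= u j ->
      (forall j, j \in seq.filter left_of J -> ~~ (u j < y < u j + a j)) ->
      exists2 c, c \in s & `|c - y| <= r.
  apply: IH => //.
  - by apply: leq_ltn_trans sJ; rewrite size_filter count_size.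
  - exact: filter_uniq.
  - move=> i; rewrite mem_filter => /andP[li iJ]; have [ai pi _] := inpq i (sub i iJ).
    by have := side i iJ; rewrite li.
  - by move=> i k; rewrite !mem_filter => /andP[_ /sub iJ] /andP[_ /sub kJ]; exact: sepJ.
have [s2 ss2 hs2] : exists2 s, (size s)%:R <= (size (seq.filter (predC left_of) J)).+1%:R +
    (q - (u j + a j) - \sum_(j <- seq.filter (predC left_of) J) a j) / r &
    forall y, u j + a j <= y <= q ->
      (forall j, j \in seq.filter (predC left_of) J -> ~~ (u j < y < u j + a j)) ->
      exists2 c, c \in s & `|c - y| <= r.
  apply: IH => //.
  - by apply: leq_ltn_trans sJ; rewrite size_filter count_size.
  - exact: filter_uniq.
  - move=> i; rewrite mem_filter => /andP[li iJ]; have [ai _ iq] := inpq i (sub i iJ).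
    by have := side i iJ; rewrite (negbTE li).
  - by move=> i k; rewrite !mem_filter => /andP[_ /sub iJ] /andP[_ /sub kJ]; exact: sepJ.
exists (s1 ++ s2).
  rewrite size_cat natrD; apply: le_trans (lerD ss1 ss2) _.
  have -> : size J = (size (seq.filter left_of J) + size (seq.filter (predC left_of) J))%N.
    by rewrite !size_filter count_predC.
  rewrite le_eqVlt; apply/orP; left; apply/eqP.
  rewrite big_cons [in RHS](bigID left_of) /= !big_filter -!natr1 natrD.
  set S1 := \sum_(_ <- J | left_of _) _.
  rewrite (_ : \sum_(_ <- J | predC _ _) _ = \sum_(i <- J | ~~ left_of i) a i) //.
  move: S1 (\sum_(_ <- J | _) _) (size _)%:R (size _)%:R => S1 S2 n1 n2.
  field; exact: lt0r_neq0.
move=> y /andP[py yq] yJ; have := yJ j (mem_head _ _).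
rewrite negb_and -!leNgt => /orP[yu|uy].
  have [|i|c cs cy] := hs1 y; first by rewrite py yu.
    by rewrite mem_filter => /andP[_ /sub]; exact: yJ.
  by exists c => //; rewrite mem_cat cs.
have [|i|c cs cy] := hs2 y; first by rewrite uy yq.
  by rewrite mem_filter => /andP[_ /sub]; exact: yJ.
by exists c => //; rewrite mem_cat cs orbT.
Qed.

End Covering.

(** * Arrangements of the gaps along a key *)

(** Ordering the gaps by [key] determines their positions: a gap starts where the
    gaps with smaller keys, put side by side, end. *)
Definition gap_left (R : realType) (a key : nat -> R) (j : nat) : R :=
  weight a (fun i => key i < key j).

Definition arrangement (R : realType) (a key : nat -> R) : set R :=
  `[0, total_length a]%classic `\`
    \bigcup_(j in [set j | (1 <= j)%N]) `]gap_left a key j, gap_left a key j + a j[%classic.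

Lemma prefix_argmax (R : realType) (key : nat -> R) (D : pred nat) n :
  (forall j, (1 <= j < n)%N -> ~~ D j) \/
  exists2 j0, (1 <= j0)%N && D j0 &
    forall j, (1 <= j < n)%N -> D j -> key j <= key j0.
Proof.
elim: n => [|n IH]; first by left => j; rewrite ltn0 andbF.
have split_lt j : (1 <= j < n.+1)%N -> j = n \/ (1 <= j < n)%N.
  by rewrite ltnS => /andP[j1]; rewrite leq_eqVlt j1 => /orP[/eqP|]; [left|right].
have [/andP[n1 Dn]|nD] := boolP ((1 <= n)%N && D n); last first.
  have no j : (1 <= j < n.+1)%N -> D j -> (1 <= j < n)%N.
    by move=> jn Dj; have [jE|//] := split_lt j jn; move: nD; rewrite -jE Dj (andP jn).1.
  case: IH => [IH|[j0 Dj0 IH]]; [left => j jn|right; exists j0 => // j jn Dj].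
    by apply/negP => Dj; move: (IH j (no j jn Dj)); rewrite Dj.
  exact: IH (no j jn Dj) Dj.
right; case: IH => [IH|[j0 Dj0 IH]].
  exists n; first by rewrite n1.
  by move=> j /split_lt[->//|/IH/negbTE->].
have [le|lt] := leP (key n) (key j0).
  by exists j0 => // j /split_lt[->//|]; exact: IH.
exists n; first by rewrite n1.
by move=> j /split_lt[->//|jn Dj]; apply: le_trans (ltW lt); exact: IH.
Qed.

Section Arrangement.
Context {R : realType} (a key : nat -> R).
Hypothesis a_gt0 : forall j, (1 <= j)%N -> 0 < a j.
Hypothesis a_sum : gap_summable a.
Hypothesis key_inj : forall i j, (1 <= i)%N -> (1 <= j)%N -> key i = key j -> i = j.

Let a_ge0 j (j1 : (1 <= j)%N) : 0 <= a j := ltW (a_gt0 j1).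
Local Notation u := (gap_left a key).
Local Notation L := (total_length a).
Local Notation E := (arrangement a key).

Lemma gap_right j : (1 <= j)%N -> u j + a j = weight a (fun i => key i <= key j).
Proof.
move=> j1; rewrite -[in LHS](weight1 a_ge0 a_sum j1); symmetry.
apply: weight_disjointU => // i i1 /=.
  rewrite le_eqVlt orbC; congr (_ || _); apply/eqP/eqP => [/key_inj->//|->//].
by apply/negP => /andP[/[swap] /eqP ->]; rewrite ltxx.
Qed.

Lemma gap_before i j : (1 <= i)%N -> (1 <= j)%N -> key i < key j -> u i + a i <= u j.
Proof.
move=> i1 j1 ij; rewrite gap_right//; apply: weight_mono => // k k1 ki.
exact: le_lt_trans ki ij.
Qed.

Lemma gap_left_ge0 j : 0 <= u j.
Proof. exact: weight_ge0. Qed.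

Lemma gap_right_le j : (1 <= j)%N -> u j + a j <= L.
Proof. by move=> j1; rewrite gap_right// -weightT; apply: weight_mono. Qed.

Lemma gap_order i j : (1 <= i)%N -> (1 <= j)%N -> i != j ->
  u i + a i <= u j \/ u j + a j <= u i.
Proof.
move=> i1 j1 ij; have [lt|gt|/key_inj e] := ltgtP (key i) (key j).
- by left; apply: gap_before.
- by right; apply: gap_before.
- by rewrite e ?eqxx in ij.
Qed.

Lemma arrangementP y :
  E y <-> 0 <= y <= L /\ forall j, (1 <= j)%N -> (y <= u j) || (u j + a j <= y).
Proof.
split=> [[/= yL nU]|[yL nU]].
  split=> [|j j1]; first by move: yL; rewrite in_itv.
  rewrite leNgt [X in _ || X]leNgt -negb_and; apply/negP => yU; apply: nU.
  by exists j => //=; rewrite in_itv.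
split=> /=; first by rewrite in_itv.
by case=> j /= /nU; rewrite in_itv/= => /orP[]; rewrite leNgt => /negbTE->; rewrite ?andbF.
Qed.

Lemma arrangement_complementary : complementary_sets a E.
Proof.
split.
  apply: closedI; first exact: interval_closed.
  by apply: open_closedC; apply: bigcup_open => j _; exact: interval_open.
exists u; split => //.
  move=> i j i1 j1 [y [/=]]; rewrite !in_itv/= => /andP[uiy yi] /andP[ujy yj].
  by apply/eqP; apply: contraT => /gap_order -/(_ i1 j1)[]; lra.
move=> j j1 y /=; rewrite !in_itv/= => /andP[uy yu].
by have := gap_left_ge0 j; have := gap_right_le j1 => ? ?; apply/andP; split; lra.
Qed.

Lemma gap_left_arrangement j : (1 <= j)%N -> E (u j).
Proof.
move=> j1; apply/arrangementP; split.
  by rewrite gap_left_ge0/=; have := gap_right_le j1; have := a_gt0 j1; lra.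
move=> i i1; have [->|ij] := eqVneq i j; first by rewrite lexx.
have [->|le] := gap_order i1 j1 ij; first by rewrite orbT.
by apply/orP; left; have := a_gt0 j1; lra.
Qed.

Lemma arrangement0 : E 0.
Proof.
apply/arrangementP; split; first by rewrite lexx -weightT weight_ge0.
by move=> j j1; rewrite gap_left_ge0.
Qed.

(** The gaps exhaust the length, so no length is left between a point and the
    gaps on its left: finitely many of those gaps are all initial in the key
    order below the last of them, and the two sides add up to the total. *)
Lemma arrangement_weight y : E y -> weight a (fun j => u j + a j <= y) = y.
Proof.
move=> /arrangementP[/andP[y0 yL] yU]; set D : pred nat := fun j => u j + a j <= y.
apply/le_anti/andP; split.
  apply: weight_le => // n; rewrite -head_weight//.
  have [none|[j0 /andP[j1 Dj0] max]] := prefix_argmax key D n.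
    rewrite head_weight// big_nat_cond big1// => j /andP[jn].
    by rewrite (negbTE (none j jn)).
  apply: le_trans Dj0; rewrite gap_right//; apply: weight_mono => // j jge /andP[Dj jn].
  by apply: max => //; rewrite jge.
suff : weight a (predC D) <= L - y.
  by have := @weightID _ _ a_ge0 a_sum D xpredT; rewrite weightT /=; lra.
apply: weight_le => // n; rewrite -head_weight//.
have [none|[j0 /andP[j1 Dj0] max]] := prefix_argmax (\- key) (predC D) n.
  rewrite head_weight// big_nat_cond big1 ?subr_ge0// => j /andP[jn].
  by rewrite (negbTE (none j jn)).
have yuj0 : y <= u j0 by move: (yU j0 j1) Dj0; rewrite /D/= => /orP[//|->].
have : u j0 + weight a (fun j => key j0 <= key j) = L.
  rewrite -weightT; symmetry; apply: weight_disjointU => // j jge; first by rewrite ltNge orNb.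
  by rewrite ltNge andNb.
suff : weight a (fun j => predC D j && (j < n)%N) <= weight a (fun j => key j0 <= key j) by lra.
apply: weight_mono => // j jge /andP[Dj jn].
by have := max j; rewrite jge jn => /(_ isT Dj) /=; rewrite lerN2.
Qed.

(** Hence the gaps on the left of a point form an initial segment of the key order. *)
Lemma cut_downward y i j : E y -> (1 <= i)%N -> (1 <= j)%N ->
  key i <= key j -> u j + a j <= y -> u i + a i <= y.
Proof.
move=> Ey i1 j1; rewrite le_eqVlt => /orP[/eqP/key_inj->//|/gap_before le yj].
by have := a_gt0 j1; have := le i1 j1; lra.
Qed.

End Arrangement.

(** * Keys of the binary tree *)

(** The nodes of the infinite binary tree are numbered as in a heap: the root is 1
    and the children of [l] are [2 * l] and [2 * l + 1]. *)
Definition level (l : nat) : nat := trunc_log 2 l.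

(** The interval [1, 2] is halved along the tree, and the key of a node is the
    midpoint of its dyadic interval; keys thus increase in infix order. *)
Definition heap_key (R : realType) (l : nat) : R :=
  (2 * l + 1)%:R / 2 ^+ (level l).+1.

(** For [2 ^ n <= v < 2 ^ n.+1] this says that [l] is a descendant of the node [v],
    whose dyadic interval is [v / 2 ^ n, (v + 1) / 2 ^ n]. *)
Definition in_node (R : realType) (n v l : nat) : bool :=
  (v%:R / 2 ^+ n < heap_key R l) && (heap_key R l < v.+1%:R / 2 ^+ n).

Lemma dyadic_le (R : realType) (m i n j : nat) :
  (m%:R / 2 ^+ i <= n%:R / 2 ^+ j :> R) = (m * 2 ^ j <= n * 2 ^ i)%N.
Proof.
by rewrite ler_pdivrMr ?exprn_gt0// mulrAC ler_pdivlMr ?exprn_gt0// -!natrX -!natrM ler_nat.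
Qed.

Lemma dyadic_lt (R : realType) (m i n j : nat) :
  (m%:R / 2 ^+ i < n%:R / 2 ^+ j :> R) = (m * 2 ^ j < n * 2 ^ i)%N.
Proof. by rewrite ltNge dyadic_le -ltnNge. Qed.

Lemma level_bounds l : (0 < l)%N -> (2 ^ level l <= l < 2 ^ (level l).+1)%N.
Proof. exact: trunc_log_bounds. Qed.

Lemma level_node n v k i : (2 ^ n <= v < 2 ^ n.+1)%N -> (i < 2 ^ k)%N ->
  level (v * 2 ^ k + i) = (n + k)%N.
Proof.
move=> /andP[nv vn] ik; apply: trunc_log_eq => //.
have := leq_mul nv (leqnn (2 ^ k)); have := leq_mul vn (leqnn (2 ^ k)).
by rewrite -!expnD addSn mulSn; lia.
Qed.

Lemma level_leaf k i : (i < 2 ^ k)%N -> level (2 ^ k + i) = k.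
Proof. by move=> ik; have := @level_node 0 1 k i isT ik; rewrite mul1n. Qed.

Lemma in_nodeE (R : realType) n v l k : level l = (n + k)%N ->
  in_node R n v l = (v * 2 ^ k <= l < v.+1 * 2 ^ k)%N.
Proof.
rewrite /in_node /heap_key => ->; rewrite !dyadic_lt expnS expnD.
have f0 : (0 < 2 ^ n)%N by rewrite expn_gt0.
move: (2 ^ n)%N (2 ^ k)%N f0 => f e f0.
rewrite (_ : v * (2 * (f * e)) = f * (2 * (v * e)))%N; last by lia.
rewrite (_ : v.+1 * (2 * (f * e)) = f * (2 * (v.+1 * e)))%N; last by lia.
by rewrite !(mulnC _ f) !ltn_pmul2l//; congr (_ && _); apply/idP/idP; lia.
Qed.

Lemma node_in_node (R : realType) n v k i : (2 ^ n <= v < 2 ^ n.+1)%N -> (i < 2 ^ k)%N ->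
  in_node R n v (v * 2 ^ k + i).
Proof. by move=> vn ik; rewrite (in_nodeE _ _ (level_node vn ik)) mulSn; lia. Qed.

Lemma in_node_node (R : realType) n v l : (0 < l)%N -> in_node R n v l ->
  exists k i, [/\ (i < 2 ^ k)%N, l = (v * 2 ^ k + i)%N & level l = (n + k)%N].
Proof.
move=> l0; have [nK|Kn] := leqP n (level l).
  have [k Kk] : exists k, level l = (n + k)%N by exists (level l - n)%N; rewrite subnKC.
  by rewrite (in_nodeE _ _ Kk) mulSn => h; exists k, (l - v * 2 ^ k)%N; split=> //; lia.
have [k ->] : exists k, n = ((level l).+1 + k)%N by exists (n - (level l).+1)%N; rewrite subnKC.
rewrite /in_node /heap_key !dyadic_lt; move: (level l).+1 => K.
have f0 : (0 < 2 ^ K)%N by rewrite expn_gt0.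
rewrite expnD; move: (2 ^ K)%N (2 ^ k)%N f0 => f e f0.
by rewrite (mulnC f e) !mulnA !ltn_pmul2r// => /andP[h1 h2]; lia.
Qed.

(** The numerators are odd, so each key is a reduced fraction. *)
Lemma heap_key_inj (R : realType) l l' : heap_key R l = heap_key R l' -> l = l'.
Proof.
rewrite /heap_key; move: (level l) (level l') => K K' e.
have {}e : ((2 * l + 1) * 2 ^ K' = (2 * l' + 1) * 2 ^ K)%N.
  have : ((2 * l + 1) * 2 ^ K'.+1 == (2 * l' + 1) * 2 ^ K.+1)%N.
    by rewrite eqn_leq -!(dyadic_le R) e lexx.
  by rewrite !expnS => /eqP; nia.
wlog KK' : l l' K K' e / (K <= K')%N.
  by move=> h; have [/h|/ltnW/h] := leqP K K'; [exact|move=> /(_ l' l) ->].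
move: e; rewrite -(subnK KK') expnD mulnA.
have : (0 < 2 ^ K)%N by rewrite expn_gt0.
move: (2 ^ K)%N => f f0 e; have {e} : ((2 * l + 1) * 2 ^ (K' - K) = 2 * l' + 1)%N by nia.
case: (K' - K)%N => [|k]; rewrite ?expnS; nia.
Qed.

Lemma heap_key_bounds (R : realType) l : (0 < l)%N -> 1 < heap_key R l < 2.
Proof.
move=> l0; have := level_bounds l0 => /andP[h1 h2].
have e1 : 1 = 1%:R / 2 ^+ 0 :> R by rewrite expr0 divr1.
have e2 : 2 = 2%:R / 2 ^+ 0 :> R by rewrite expr0 divr1.
rewrite [X in X < _ < _]e1 [X in _ < _ < X]e2 /heap_key !dyadic_lt expn0.
by move: h2; rewrite !expnS => h2; apply/andP; split; lia.
Qed.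

(** * Scales *)

(** The scales [t n] of a tree with [2 ^ k] descendants per node after [k] steps:
    the count [2 ^ k] dominates the ratio of scales to the power [alpha]. *)
Definition slow_decay (R : realType) (t : nat -> R) (alpha : R) : Prop :=
  exists2 c, 0 < c & forall n k, c * (t n / t (n + k)%N) `^ alpha <= 2 ^+ k.

Section Scales.
Context {R : realType} (t : nat -> R) (beta : R).
Hypothesis t_gt0 : forall n, 0 < t n.
Hypothesis beta_lt : beta < 2^-1.
Hypothesis t_ratio : forall n, t n.+1 <= beta * t n.

Lemma scale_ratio_gt0 : 0 < beta.
Proof. by rewrite -(pmulr_lgt0 _ (t_gt0 0)); apply: lt_le_trans (t_ratio 0). Qed.

Lemma scale_pow n k : t (n + k)%N <= beta ^+ k * t n.
Proof.
elim: k => [|k IH]; first by rewrite addn0 mul1r.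
rewrite addnS exprS -mulrA; apply: le_trans (t_ratio _) _.
by rewrite ler_pM2l// scale_ratio_gt0.
Qed.

Lemma scale_double n : 2 * t n.+1 <= t n.
Proof. by have := t_ratio n; have := t_gt0 n; have := beta_lt; nra. Qed.

Lemma scale_decr m n : (m <= n)%N -> t n <= t m.
Proof.
move=> /subnKC <-; elim: (n - m)%N => [|k IH]; first by rewrite addn0.
by rewrite addnS; have := scale_double (m + k); have := t_gt0 (m + k).+1; lra.
Qed.

Lemma scale_vanish e : 0 < e -> exists n, t n <= e.
Proof.
move=> e0; pose n := Num.bound (t 0%N / e); exists n.
have : t n * 2 ^+ n <= t 0%N.
  elim: n => [|n IH]; first by rewrite mulr1.
  by rewrite exprS mulrCA mulrA; apply: le_trans IH; rewrite ler_pM2r ?exprn_gt0 ?scale_double.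
have := upper_nthrootP (leqnn n); rewrite ltr_pdivrMr// => lt le.
have p0 : 0 < 2 ^+ n :> R by rewrite exprn_gt0.
by rewrite -(ler_pM2r p0); apply: le_trans le (ltW _); rewrite mulrC.
Qed.

(** A node at depth [n] has [2 ^ k] descendants at depth [n + k]; as the scales
    shrink by more than a factor 2, the whole subtree is comparable to its root. *)
Lemma subtree_sum n m :
  \sum_(k <- iota 0 m) 2 ^+ k * t (n + k)%N <= t n / (1 - 2 * beta).
Proof.
have b0 : 0 < 1 - 2 * beta by move: beta_lt; lra.
elim: m n => [|m IH] n; first by rewrite big_nil divr_ge0 ?ltW.
rewrite -[iota 0 m.+1]/(0%N :: iota (1 + 0) m) big_cons expr0 mul1r addn0 iotaDl big_map.
have -> : \sum_(j <- iota 0 m) 2 ^+ (1 + j) * t (n + (1 + j))%N =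
          2 * \sum_(j <- iota 0 m) 2 ^+ j * t (n.+1 + j)%N.
  by rewrite big_distrr; apply: eq_bigr => j _ /=; rewrite add1n exprS mulrA addnS.
have le1 := IH n.+1; have le2 := t_ratio n; move: le1.
move: (\sum_(_ <- _) _) => S; rewrite !ler_pdivlMr// => le1.
by have : 2 * (S * (1 - 2 * beta)) <= 2 * (beta * t n); [lra | move: le1 le2; nra].
Qed.

End Scales.

Lemma expr_unbounded (R : realType) (w b : R) : 1 < w -> exists n, b < w ^+ n.
Proof.
move=> w1; have w0 : 0 < w - 1 by rewrite subr_gt0.
have bern n : 1 + n%:R * (w - 1) <= w ^+ n.
  elim: n => [|n IH]; first by rewrite mul0r addr0.
  have {}IH : w * (1 + n%:R * (w - 1)) <= w * w ^+ n by rewrite ler_pM2l//; lra.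
  have sq : 0 <= n%:R * (w - 1) ^+ 2 by rewrite mulr_ge0// sqr_ge0.
  have -> : n.+1%:R = n%:R + 1 :> R by rewrite natr1.
  rewrite exprS; apply: le_trans IH; rewrite -subr_ge0.
  by rewrite (_ : _ - _ = n%:R * (w - 1) ^+ 2) //; ring.
exists (Num.bound (`|b| / (w - 1))); apply: lt_le_trans (bern _).
have : `|b| / (w - 1) < (Num.bound (`|b| / (w - 1)))%:R.
  by apply: archi_boundP; rewrite divr_ge0// ltW.
by rewrite ltr_pdivrMr//; have := ler_norm b; lra.
Qed.

Lemma powR_exprn (R : realType) (y x : R) k : 0 <= y -> (y ^+ k) `^ x = (y `^ x) ^+ k.
Proof.
move=> y0; elim: k => [|k IH]; first by rewrite !expr0 powR1.
by rewrite !exprS powRM ?exprn_ge0// IH.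
Qed.

Lemma powR_rootK (R : realType) (x alpha : R) : 0 <= x -> alpha != 0 ->
  (x `^ alpha^-1) `^ alpha = x.
Proof. by move=> x0 al0; rewrite -powRrM mulVf// powRr1. Qed.

Lemma powR_le_root (R : realType) (x y alpha : R) : 0 <= x -> 0 < alpha -> x `^ alpha <= y ->
  x <= y `^ alpha^-1.
Proof.
move=> x0 al0 xy; rewrite -[leLHS]powRr1// -(mulfV (lt0r_neq0 al0)) powRrM.
have iv0 : 0 <= alpha^-1 by rewrite invr_ge0 ltW.
by apply: (ge0_ler_powR iv0) => //; rewrite nnegrE ?powR_ge0// (le_trans (powR_ge0 _ _) xy).
Qed.

(** The case [k = 1] of slow decay bounds the ratio of consecutive scales. *)
Lemma slow_decay_doubling (R : realType) (t : nat -> R) alpha : (forall n, 0 < t n) -> 0 < alpha ->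
  slow_decay t alpha -> exists2 M, 0 < M & forall n, t n <= M * t n.+1.
Proof.
move=> t0 al0 [c c0 h]; exists ((2 / c) `^ alpha^-1); first by rewrite powR_gt0 ?divr_gt0.
move=> n; rewrite -ler_pdivrMr//; apply: powR_le_root => //; first by rewrite divr_ge0 ?ltW.
by rewrite ler_pdivlMr// mulrC; have := h n 1%N; rewrite addn1 expr1.
Qed.

Section Decay.
Context {R : realType}.

Lemma slow_decay_mono (t : nat -> R) beta (x alpha : R) :
  (forall n, 0 < t n) -> beta < 2^-1 -> (forall n, t n.+1 <= beta * t n) ->
  x <= alpha -> slow_decay t alpha -> slow_decay t x.
Proof.
move=> t0 blt tr xal [c c0 h]; exists c => // n k; apply: le_trans (h n k).
rewrite ler_pM2l//; apply: ler_powR xal.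
by rewrite ler_pdivlMr// mul1r (scale_decr t0 blt tr (leq_addr k n)).
Qed.

Lemma slow_decay_geometric (delta sg x : R) : 0 < delta -> 0 < sg -> sg `^ x = 2 ->
  slow_decay (fun i => delta / sg ^+ i) x.
Proof.
move=> d0 sg0 sgx; exists 1 => // n k; rewrite mul1r.
have -> : delta / sg ^+ n / (delta / sg ^+ (n + k)) = sg ^+ k.
  by rewrite exprD; field; rewrite !lt0r_neq0 ?exprn_gt0.
by rewrite powR_exprn ?(ltW sg0)// sgx.
Qed.

(** Scales that shrink by a factor [beta] at each step decay at least like the
    powers of [beta], so a slow decay exponent bounds [beta] from below. *)
Lemma slow_decay_ratio (t : nat -> R) beta (x alpha : R) :
  (forall n, 0 < t n) -> (forall n, t n.+1 <= beta * t n) ->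
  0 < x -> x <= alpha -> slow_decay t alpha -> (2 `^ x^-1)^-1 <= beta.
Proof.
move=> t0 tr x0 xal; have al0 := lt_le_trans x0 xal.
have b0 := scale_ratio_gt0 t0 tr => -[c c0 h].
have ib : beta^-1 `^ alpha <= 2.
  rewrite leNgt; apply/negP => gt2.
  have [|k] := @expr_unbounded _ (beta^-1 `^ alpha / 2) c^-1; first by rewrite ltr_pdivlMr ?mul1r.
  rewrite exprMn exprVn ltr_pdivlMr ?exprn_gt0// ltNge => /negP; apply.
  rewrite mulrC ler_pdivlMr// mulrC; apply: le_trans (h 0%N k).
  rewrite ler_pM2l// -powR_exprn ?invr_ge0 ?(ltW b0)//.
  apply: (ge0_ler_powR (ltW al0)); rewrite ?nnegrE ?exprn_ge0 ?invr_ge0 ?divr_ge0 ?(ltW b0) ?(ltW (t0 _))//.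
  rewrite exprVn ler_pdivlMr// mulrC ler_pdivrMr ?exprn_gt0// mulrC.
  exact: (scale_pow t0 tr 0).
have le1 : beta^-1 <= 2 `^ alpha^-1 by apply: powR_le_root; rewrite ?invr_ge0 ?(ltW b0).
rewrite invf_ple ?posrE ?powR_gt0//; apply: le_trans le1 _.
by apply: ler_powR; [rewrite ler1n|rewrite lef_pV2].
Qed.

End Decay.

Lemma sum_sub_uniq (R : realType) (f : nat -> R) (s s' : seq nat) :
  (forall l, l \in s' -> 0 <= f l) -> uniq s -> {subset s <= s'} ->
  \sum_(l <- s) f l <= \sum_(l <- s') f l.
Proof.
elim: s s' => [|x s IH] s' /= f0; first by rewrite big_nil big_seq sumr_ge0.
move=> /andP[xs us] ss'; have xs' := ss' x (mem_head _ _).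
rewrite (perm_big _ (perm_to_rem xs')) !big_cons lerD2l; apply: IH => // y ys.
  by apply: f0; apply: mem_rem ys.
apply: rem_mem; first by apply: contraNneq xs => <-.
by apply: ss'; rewrite inE ys orbT.
Qed.

(** * Trees of gaps inside an arrangement *)

(** A point determines a branch of the tree: at each node it is on the left or on
    the right of the gap. This is phrased for an initial segment [D] of gaps, and
    the nodes on the branch may carry no gap at all, so the branch turns right as
    soon as every gap up to the midpoint belongs to [D]. *)
Lemma branch_exists (R : realType) (A D : pred nat) (label : nat -> nat) n :
    (forall j, (1 <= j)%N -> A j -> (0 < label j)%N) ->
    (forall i j, (1 <= i)%N -> (1 <= j)%N -> A i -> A j ->
       heap_key R (label i) <= heap_key R (label j) -> D j -> D i) ->
  exists2 v, (2 ^ n <= v < 2 ^ n.+1)%N & forall j, (1 <= j)%N -> A j ->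
    (heap_key R (label j) <= v%:R / 2 ^+ n -> D j) /\
    (v.+1%:R / 2 ^+ n <= heap_key R (label j) -> ~~ D j).
Proof.
move=> label_gt0 downD; elim: n => [|n [v vn IH]].
  exists 1%N => // j j1 Aj; have /andP[k1 k2] := heap_key_bounds R (label_gt0 j j1 Aj).
  by rewrite expr0 !divr1; split; [move: k1|move: k2]; rewrite ltNge => /negbTE ->.
have double w : w%:R / 2 ^+ n = (2 * w)%:R / 2 ^+ n.+1 :> R.
  by apply/le_anti; rewrite !dyadic_le !expnS; apply/andP; split; nia.
pose mid := (2 * v + 1)%:R / 2 ^+ n.+1 : R.
have [all_in|] := pselect (forall j, (1 <= j)%N -> A j -> heap_key R (label j) <= mid -> D j).
  exists (2 * v + 1)%N; first by rewrite !expnS; move: vn; rewrite expnS; lia.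
  move=> j j1 Aj; split; first exact: all_in.
  have [_] := IH j j1 Aj; rewrite double.
  by rewrite (_ : (2 * v + 1).+1 = 2 * v.+1)%N //; lia.
move=> /existsNP[i /not_implyP[i1 /not_implyP[Ai /not_implyP[i_mid nDi]]]].
exists (2 * v)%N; first by rewrite !expnS; move: vn; rewrite expnS; lia.
move=> j j1 Aj; split; first by have [+ _] := IH j j1 Aj; rewrite double.
rewrite -addn1 => mid_j; apply/negP => Dj; apply: nDi; apply: downD Dj => //.
exact: le_trans i_mid mid_j.
Qed.

(** Membership of [y] in the part of the arrangement that the gaps in [A] span: no
    other gap lies between [y] and a gap in [A]. *)
Definition in_part (R : realType) (a key : nat -> R) (A : pred nat) (y : R) : Prop :=
  forall j w, (1 <= j)%N -> (1 <= w)%N -> ~~ A j -> A w ->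
    (gap_left a key j + a j <= y) = (key j < key w).

(** The gaps in [A] are placed along the binary tree, with [label] the node of a
    gap. Nodes may be vacant, but not the even ones; the gaps at depth [n] have
    length comparable to [t n]. *)
Section Part.
Context {R : realType} (a key : nat -> R).
Hypothesis a_gt0 : forall j, (1 <= j)%N -> 0 < a j.
Hypothesis a_sum : gap_summable a.
Hypothesis key_inj : forall i j, (1 <= i)%N -> (1 <= j)%N -> key i = key j -> i = j.
Local Notation u := (gap_left a key).
Local Notation E := (arrangement a key).

Context (A : pred nat) (label : nat -> nat) (base : R) (t : nat -> R) (p q beta : R).
Hypothesis label_gt0 : forall j, (1 <= j)%N -> A j -> (0 < label j)%N.
Hypothesis label_inj : forall i j, (1 <= i)%N -> (1 <= j)%N -> A i -> A j ->
  label i = label j -> i = j.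
Hypothesis A_key : forall j, (1 <= j)%N -> A j -> key j = base + heap_key R (label j).
Hypothesis A_le : forall j, (1 <= j)%N -> A j -> a j <= q * t (level (label j)).
Hypothesis A_ge : forall l, (2 <= l)%N -> ~~ odd l ->
  exists j, [/\ (1 <= j)%N, A j, label j = l & p * t (level l) <= a j].
Hypothesis t_gt0 : forall n, 0 < t n.
Hypothesis p_gt0 : 0 < p.
Hypothesis q_gt0 : 0 < q.
Hypothesis beta_lt : beta < 2^-1.
Hypothesis t_ratio : forall n, t n.+1 <= beta * t n.

Let a_ge0 j (j1 : (1 <= j)%N) : 0 <= a j := ltW (a_gt0 j1).

Let reach := q / (1 - 2 * beta).

(** The diameter of the part of the set below the node [v]. *)
Lemma subtree_weight n v : (2 ^ n <= v < 2 ^ n.+1)%N ->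
  weight a (fun j => A j && in_node R n v (label j)) <= reach * t n.
Proof.
move=> vn; apply: weight_le => // N; pose Z j := A j && in_node R n v (label j).
pose s := seq.filter Z (index_iota 1 N).
have sP j : j \in s -> [/\ (1 <= j)%N, A j & in_node R n v (label j)].
  by rewrite mem_filter mem_index_iota => /andP[/andP[? ?] /andP[? _]].
rewrite -[X in X <= _]/(\sum_(1 <= j < N | Z j) a j).
have -> : \sum_(1 <= j < N | Z j) a j = \sum_(j <- s) a j by rewrite big_filter.
apply: (@le_trans _ _ (q * \sum_(l <- map label s) t (level l))).
  rewrite big_map big_distrr /= big_seq [leRHS]big_seq; apply: ler_sum => j /sP[j1 Aj _].
  exact: A_le.
rewrite /reach mulrAC -mulrA ler_pM2l//.
pose K := (\max_(j <- s) label j).+1.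
pose s' := [seq (v * 2 ^ k + i)%N | k <- iota 0 K, i <- iota 0 (2 ^ k)].
apply: (@le_trans _ _ (\sum_(l <- s') t (level l))).
  apply: sum_sub_uniq => [l _||l]; first exact: ltW.
    rewrite map_inj_in_uniq ?filter_uniq ?iota_uniq// => i j /sP[i1 Ai _] /sP[j1 Aj _].
    exact: label_inj.
  move=> /mapP[j js ->]; have [j1 Aj inj] := sP j js.
  have [k [i [ik lE lev]]] := in_node_node (label_gt0 j1 Aj) inj.
  rewrite lE; apply/allpairsPdep; exists k, i; split => //; rewrite mem_iota //=.
  rewrite add0n ltnS; apply: (@leq_trans (label j)); last exact: (@leq_bigmax_seq _ _ xpredT label).
  rewrite lE; apply: leq_trans (leq_addr _ _); apply: leq_trans (ltnW (ltn_expl k (ltnSn 1))) _.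
  by apply: leq_pmull; move: vn => /andP[+ _]; apply: leq_trans; rewrite expn_gt0.
rewrite big_allpairs_dep /=; apply: le_trans (subtree_sum t_gt0 beta_lt t_ratio n K).
apply: ler_sum => k _; rewrite big_seq.
rewrite (eq_bigr (fun=> t (n + k)%N)); last first.
  by move=> i; rewrite mem_iota /= add0n => ik; rewrite (level_node vn ik).
by rewrite -big_seq big_const_seq count_predT size_iota iter_addr_0 -natrX mulr_natl.
Qed.

(** The branch of [y] passes through a node of depth [n], all of whose descendants
    are within [reach * t n] of [y]; half of those at depth [n + k] are even, and
    their gaps are longer than [2 * r]. *)
Lemma part_count y n k d r : E y -> in_part a key A y -> 0 < r -> reach * t n <= d ->
    2 * r < p * t (n + k)%N ->
  (((2 ^ k)%:R / 2)%:E <= covering_number r (closed_ball y d `&` E))%E.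
Proof.
move=> Ey y_part r0 nd kr.
have d0 : 0 < d.
  apply: lt_le_trans nd; rewrite mulr_gt0 ?divr_gt0//; move: beta_lt; lra.
case: k kr => [|k] kr.
  apply: le_trans (covering_number_ge1 r0 (conj _ Ey)); first by rewrite lee_fin; lra.
  by rewrite closed_ballE// /closed_ball_ /= subrr normr0 ltW.
have downD i j : (1 <= i)%N -> (1 <= j)%N -> A i -> A j ->
    heap_key R (label i) <= heap_key R (label j) -> u j + a j <= y -> u i + a i <= y.
  move=> i1 j1 Ai Aj ij; apply: (cut_downward a_gt0 a_sum key_inj) => //.
  by rewrite !A_key// lerD2l.
have [v vn vP] := branch_exists n label_gt0 downD.
have lab_lt (i : 'I_(2 ^ k)) : (2 * i < 2 ^ k.+1)%N by rewrite expnS ltn_pmul2l.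
have /choice[g gP] : forall i : 'I_(2 ^ k), exists j, [/\ (1 <= j)%N, A j,
    label j = (v * 2 ^ k.+1 + 2 * i)%N & p * t (n + k.+1)%N <= a j].
  move=> i; rewrite -(level_node vn (lab_lt i)); apply: A_ge.
    apply: leq_trans (leq_addr _ _); rewrite expnS mulnCA; apply: leq_pmulr.
    by rewrite muln_gt0 expn_gt0 andbT; move: vn => /andP[+ _]; apply: leq_trans; rewrite expn_gt0.
  by rewrite oddD expnS mulnCA !oddM.
have -> : (2 ^ k.+1)%:R / 2 = (2 ^ k)%:R :> R by rewrite expnS natrM mulrC mulKf.
apply: (@covering_number_ge_card _ _ _ _ (u \o g)) => // [i|i i' ii'] /=.
  have [j1 Aj labj _] := gP i; split; last exact: gap_left_arrangement.
  rewrite closed_ballE// /closed_ball_ /=; apply: le_trans nd.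
  apply: le_trans (subtree_weight vn); rewrite -[X in `|X - _|](arrangement_weight a_gt0 a_sum key_inj Ey).
  apply: weight_dist => // m m1; have [Am|nAm] := boolP (A m); last by rewrite (y_part m (g i)) ?eqxx.
  have in_g : in_node R n v (label (g i)) by rewrite labj; apply: node_in_node.
  have [lo hi] := vP m m1 Am; move: in_g => /andP[vg gv]; rewrite !A_key// ltrD2l /=.
  apply: contraR; rewrite /in_node negb_and -!leNgt => /orP[mv|vm].
    by rewrite lo// (le_lt_trans mv vg).
  by rewrite (negbTE (hi vm)) ltNge (le_trans (ltW gv) vm).
have [j1 Aj labj aj] := gP i; have [j1' Aj' labj' aj'] := gP i'.
have gij : g i != g i'.
  apply: contraNneq ii' => e; apply/eqP/val_inj => /=; move: labj; rewrite e labj'.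
  by move=> /eqP; rewrite eqn_add2l eqn_pmul2l// => /eqP.
have [le|le] := gap_order a_gt0 a_sum key_inj j1 j1' gij.
  by rewrite distrC ger0_norm; lra.
by rewrite ger0_norm; lra.
Qed.

(** Choose the depth [n] of a node of size about [d] and the depth [n + k] whose
    gaps have length about [r]; the even descendants alone give [2 ^ k / 2]
    separated points, and the decay of [t] compares this with [d / r]. *)
Lemma part_lower_bound alpha : 0 < alpha -> slow_decay t alpha ->
  exists c rho, [/\ 0 < c, 0 < rho & forall y r d, E y -> in_part a key A y ->
    0 < r -> r < d -> d < rho ->
    ((c * (d / r) `^ alpha)%:E <= covering_number r (closed_ball y d `&` E))%E].
Proof.
move=> al0 [c0 c00 slow].
have reach0 : 0 < reach by rewrite divr_gt0//; move: beta_lt; lra.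
pose D := 2 * reach / p.
have D0 : 0 < D by rewrite divr_gt0// mulr_gt0.
exists (c0 / (8 * D `^ alpha)), (reach * t 0%N).
have DA0 : 0 < D `^ alpha by apply: powR_gt0.
split; [by rewrite divr_gt0// mulr_gt0|exact: mulr_gt0|] => y r d Ey yp r0 rd drho.
have d0 : 0 < d := lt_trans r0 rd.
have ex_n : exists n, reach * t n <= d.
  have [|n hn] := scale_vanish t_gt0 beta_lt t_ratio (e := d / reach); first exact: divr_gt0.
  by exists n; rewrite mulrC -ler_pdivlMr.
case: (ex_minnP ex_n) => -[|n] hn min_n; first by move: hn; rewrite leNgt drho.
have {min_n} dn : d < reach * t n by rewrite ltNge; apply/negP => /min_n; rewrite ltnn.
have ex_k : exists k, p * t (n.+2 + k)%N <= 2 * r.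
  have [|k hk] := scale_vanish t_gt0 beta_lt t_ratio (e := 2 * r / p).
    by rewrite divr_gt0// mulr_gt0.
  exists k; rewrite mulrC -ler_pdivlMr//; apply: le_trans hk.
  exact: (scale_decr t_gt0 beta_lt t_ratio (leq_addl _ _)).
have [k kr le_count] : exists2 k, p * t (n.+2 + k)%N <= 2 * r &
    (((2 ^ k)%:R / 2)%:E <= covering_number r (closed_ball y d `&` E))%E.
  case: (ex_minnP ex_k) => -[|k] kr min_k.
    exists 0%N => //; apply: le_trans (covering_number_ge1 r0 (conj _ Ey)); first by rewrite lee_fin; lra.
    by rewrite closed_ballE// /closed_ball_ /= subrr normr0 ltW.
  exists k.+1 => //; apply: (@part_count _ n.+1) => //.
  by rewrite ltNge addnS -addSn; apply/negP => /min_k; rewrite ltnn.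
apply: le_trans le_count; rewrite lee_fin.
have tk := t_gt0 (n.+2 + k); have tn := t_gt0 n.
have drD : d / r <= D * (t n / t (n.+2 + k)%N).
  have -> : D * (t n / t (n.+2 + k)%N) = reach * t n * (2 * r) / (p * t (n.+2 + k)%N) / r.
    by rewrite /D; field; rewrite !gt_eqF.
  rewrite ler_pM2r ?invr_gt0// ler_pdivlMr ?mulr_gt0//.
  by apply: ler_pM => //; [exact: ltW|rewrite ltW ?mulr_gt0|exact: ltW].
have : (d / r) `^ alpha <= D `^ alpha * (t n / t (n.+2 + k)%N) `^ alpha.
  have T0 : 0 <= t n / t (n.+2 + k)%N by rewrite divr_ge0 ?ltW.
  rewrite -powRM ?(ltW D0)//; apply: (ge0_ler_powR (ltW al0)) => //; rewrite nnegrE.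
    by rewrite divr_ge0 ?ltW.
  by rewrite mulr_ge0// ltW.
have := slow n k.+2; rewrite addnS addnS -!addSn natrX !exprS.
move: (_ `^ alpha) (_ `^ alpha) (D `^ alpha) DA0 => X Y Z Z0 h1 h2.
rewrite mulrAC ler_pdivrMr ?mulr_gt0//.
have : c0 * X <= c0 * (Z * Y) by rewrite ler_pM2l.
have : Z * (c0 * Y) <= Z * (2 * (2 * 2 ^+ k)) by rewrite ler_pM2l.
lra.
Qed.

End Part.

(** * The associated Cantor set as an arrangement *)

Section Cantor.
Context {R : realType} (a : nat -> R).
Hypothesis a_gt0 : forall j, (1 <= j)%N -> 0 < a j.
Hypothesis a_sum : gap_summable a.

Let a_ge0 j (j1 : (1 <= j)%N) : 0 <= a j := ltW (a_gt0 j1).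
Local Notation hkey := (heap_key R).

(** Level by level, the descendants of a node are consecutive indices, which is how
    the length of an interval of the construction is defined. *)
Lemma node_partial_sum k v n : (2 ^ k <= v < 2 ^ k.+1)%N ->
  \sum_(1 <= l < 2 ^ (k + n) | in_node R k v l) a l =
  \sum_(0 <= i < n) \sum_((v - 2 ^ k) * 2 ^ i <= m < (v - 2 ^ k).+1 * 2 ^ i) a (2 ^ (k + i) + m)%N.
Proof.
move=> vk; elim: n => [|n IH].
  rewrite addn0 [RHS]big_geq// big_nat_cond big1// => l /andP[/andP[l1 lk] /in_node_node].
  case=> // i [m [_ _ lev]]; have := level_bounds l1.
  by rewrite lev => /andP[+ _]; have := leq_pexp2l (isT : 0 < 2)%N (leq_addr i k); lia.
rewrite addnS big_nat_recr//= (@big_cat_nat _ _ _ (2 ^ (k + n))) ?expn_gt0 ?leq_pexp2l//= IH.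
congr (_ + _); rewrite -{1}[(2 ^ (k + n))%N]add0n big_addn expnS mul2n -addnn addnK.
set w := (v - 2 ^ k)%N.
have wk : (w.+1 * 2 ^ n <= 2 ^ (k + n))%N.
  by rewrite expnD leq_mul2r; move: vk; rewrite /w expnS; lia.
rewrite (big_nat_widen _ _ _ _ _ wk) [RHS](@big_nat_widenl _ _ _ _ 0)//.
rewrite [LHS]big_mkcond [RHS]big_mkcond /=. apply: eq_big_nat => m /andP[_ mk].
suff -> : in_node R k v (m + 2 ^ (k + n)) = (m < w.+1 * 2 ^ n)%N && (w * 2 ^ n <= m)%N.
  by rewrite addnC.
rewrite addnC (in_nodeE _ _ (level_leaf mk)).
have -> : v = (2 ^ k + w)%N by rewrite /w subnKC//; case/andP: vk.
by rewrite -addnS !mulnDl expnD; lia.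
Qed.

Lemma cantor_length_weight k j : (1 <= j <= 2 ^ k)%N ->
  cantor_length a k j = weight a (in_node R k (2 ^ k + j.-1)).
Proof.
case: j => // j /= jk; have vk : (2 ^ k <= 2 ^ k + j < 2 ^ k.+1)%N by rewrite expnS; lia.
have e n : \sum_(0 <= i < n) \sum_(j * 2 ^ i <= m < j.+1 * 2 ^ i) a (2 ^ (k + i) + m)%N =
    \sum_(1 <= l < 2 ^ (k + n) | in_node R k (2 ^ k + j) l) a l.
  by rewrite node_partial_sum// addKn.
rewrite /cantor_length /= (_ : (fun n => _) = (fun n =>
    \sum_(1 <= l < 2 ^ (k + n) | in_node R k (2 ^ k + j) l) a l)); last exact/funext.
have nd : nondecreasing_seq (fun n => \sum_(1 <= l < 2 ^ (k + n) | in_node R k (2 ^ k + j) l) a l).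
  by move=> m n mn; apply: partial_weight_mono => //; rewrite leq_pexp2l// leq_add2l.
have cv : cvgn (fun n => \sum_(1 <= l < 2 ^ (k + n) | in_node R k (2 ^ k + j) l) a l).
  apply: nondecreasing_is_cvgn => //; exists (weight a (in_node R k (2 ^ k + j))) => _ [n _ <-].
  exact: partial_weight_le.
apply/le_anti/andP; split.
  by apply: limr_le => //; apply: nearW => n; exact: partial_weight_le.
apply: weight_le => // n; apply: le_trans (nondecreasing_cvgn_le nd cv n).
apply: partial_weight_mono => //; apply: leq_trans (ltnW (ltn_expl n (ltnSn 1))) _.
by rewrite leq_pexp2l// leq_addl.
Qed.

(** To the left of [I^k_j] lie the gaps with key up to the left end of the dyadic
    interval of its node [2 ^ k + j - 1]. *)
Lemma cantor_left_weight k j : (1 <= j <= 2 ^ k)%N ->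
  cantor_left a k j = weight a (fun i => hkey i <= (2 ^ k + j.-1)%:R / 2 ^+ k).
Proof.
have double (w n : nat) : w%:R / 2 ^+ n = (2 * w)%:R / 2 ^+ n.+1 :> R.
  by apply/le_anti; rewrite !dyadic_le !expnS; apply/andP; split; nia.
elim: k j => [|k IH] j jk.
  have -> : j = 1%N by move: jk; rewrite expn0; lia.
  apply/le_anti/andP; split; first exact: weight_ge0.
  apply: weight_le => // n; rewrite big_nat_cond big1// => i /andP[/andP[i1 _]].
  by have /andP[+ _] := heap_key_bounds R i1; rewrite expr0 divr1 ltNge => /negbTE ->.
have [p pj pk] : exists2 p, uphalf j = p.+1 & (p < 2 ^ k)%N.
  by exists (uphalf j).-1; move: jk; rewrite expnS; lia.
rewrite [LHS]/= pj IH/=; last exact: pk.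
case: ifP => oj.
  rewrite addr0 double; congr (weight a _); apply/funext => i; congr (_ <= _%:R / _).
  by move: pj; rewrite expnS; lia.
have jE : j = (2 * p).+2 by move: pj oj; lia.
rewrite cantor_length_weight; last by rewrite expnS; lia.
have -> : (2 ^ k.+1 + j.-1.-1 = 2 * (2 ^ k + p))%N by rewrite expnS; move: pj; lia.
have -> : (2 ^ k.+1 + j.-1 = (2 * (2 ^ k + p)).+1)%N by rewrite expnS; move: pj jk; lia.
have -> : (2 ^ k + p.+1 - 1 = 2 ^ k + p)%N by lia.
set v := (2 ^ k + p)%N.
have v1 : (1 <= v)%N by rewrite /v addn_gt0 expn_gt0.
have kv : hkey v = (2 * v).+1%:R / 2 ^+ k.+1 by rewrite /hkey /v level_leaf// addn1.
rewrite -[in LHS](weight1 a_ge0 a_sum v1) double; symmetry.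
have lt_mid : (2 * v)%:R / 2 ^+ k.+1 < (2 * v).+1%:R / 2 ^+ k.+1 :> R.
  by rewrite dyadic_lt ltn_mul2r expn_gt0 ltnSn.
rewrite -(weight_disjointU a_ge0 a_sum (A := fun i => in_node R k.+1 (2 * v) i || pred1 v i)) //.
  apply: weight_disjointU => // i i1.
    rewrite /in_node /= -kv [LHS]le_eqVlt; have [->|ne] := eqVneq i v; first by rewrite eqxx !orbT.
    have -> : (hkey i == hkey v) = false.
      by apply/negbTE; apply: contraNneq ne => /heap_key_inj ->.
    rewrite orbF /=; have [le|//] := leP (hkey i) ((2 * v)%:R / 2 ^+ k.+1).
    by rewrite (le_lt_trans le)// kv.
  rewrite /in_node /= negb_and; have [le|lt //] := leP (hkey i) _; rewrite /=.
  by apply/eqP => ie; move: le; rewrite ie kv leNgt lt_mid.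
move=> i i1 /=; apply/negP => /andP[/[swap]/eqP-> /andP[_]].
by rewrite kv ltxx.
Qed.

Lemma cantor_right_weight k j : (1 <= j <= 2 ^ k)%N ->
  cantor_left a k j + cantor_length a k j =
  weight a (fun i => hkey i < (2 ^ k + j.-1).+1%:R / 2 ^+ k).
Proof.
move=> jk; rewrite cantor_left_weight// cantor_length_weight//; symmetry.
set v := (2 ^ k + j.-1)%N.
have vv : v%:R / 2 ^+ k < v.+1%:R / 2 ^+ k :> R by rewrite dyadic_lt ltn_mul2r expn_gt0 ltnSn.
apply: weight_disjointU => // i i1; rewrite /in_node.
  by have [le|//] := leP (hkey i) (v%:R / 2 ^+ k); rewrite (le_lt_trans le vv).
by rewrite negb_and; have [le|//] := leP (hkey i) (v%:R / 2 ^+ k).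
Qed.

(** A point that avoids all gaps follows a branch, hence lies in one interval of
    each step; conversely the gap [j] is bordered by two intervals of step
    [level j + 1]. *)
Lemma cantor_set_arrangement : cantor_set a = arrangement a hkey.
Proof.
have kinj i j : (1 <= i)%N -> (1 <= j)%N -> hkey i = hkey j -> i = j.
  by move=> _ _; exact: heap_key_inj.
apply/seteqP; split => y.
  move=> Cy; apply/arrangementP.
  have inC k : (1 <= k)%N -> exists2 j, (1 <= j <= 2 ^ k)%N &
      cantor_left a k j <= y <= cantor_left a k j + cantor_length a k j.
    by move=> k1; have [j jk] := Cy k k1; rewrite /cantor_interval /= in_itv; exists j.
  split=> [|j j1].
    have [j jk] := inC 1%N isT; rewrite cantor_right_weight// cantor_left_weight//.
    move=> /andP[lo hi]; apply/andP; split; first by apply: le_trans lo; exact: weight_ge0.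
    by apply: le_trans hi _; rewrite -weightT; apply: weight_mono.
  have [i ik] := inC (level j).+1 isT.
  rewrite cantor_right_weight// cantor_left_weight//; set v := (_ + _)%N => /andP[lo hi].
  have [le|lt] := leqP (2 * j + 1) v; apply/orP; [right|left].
    rewrite gap_right//; apply: le_trans lo; apply: weight_mono => // m m1 /le_trans; apply.
    by rewrite dyadic_le leq_mul2r le orbT.
  apply: le_trans hi _; apply: weight_mono => // m m1 /lt_le_trans; apply.
  by rewrite dyadic_le leq_mul2r lt orbT.
move=> Ey k /= k1; set u := gap_left a hkey.
have [v vk vP] := @branch_exists R xpredT (fun j => u j + a j <= y) id k (fun j j1 _ => j1)
  (fun i j i1 j1 _ _ => @cut_downward R a hkey a_gt0 a_sum kinj y i j Ey i1 j1).
have jk : (1 <= (v - 2 ^ k).+1 <= 2 ^ k)%N by move: vk; rewrite expnS; lia.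
exists (v - 2 ^ k).+1 => //; rewrite /cantor_interval /= in_itv/=.
rewrite cantor_right_weight// cantor_left_weight//= subnKC; last by case/andP: vk.
rewrite -(arrangement_weight a_gt0 a_sum kinj Ey).
apply/andP; split; apply: weight_mono => // j j1; first exact: (vP j j1 isT).1.
by apply: contraTT; rewrite -leNgt; apply: (vP j j1 isT).2.
Qed.

End Cantor.

(** * Lower exponents *)

Definition lower_exponent (R : realType) (F : set R) (alpha : R) : Prop :=
  exists c rho, [/\ 0 < c, 0 < rho & forall x r d, F x -> 0 < r -> r < d -> d < rho ->
    ((c * (d / r) `^ alpha)%:E <= covering_number r (closed_ball x d `&` F))%E].

Section Exponents.
Context {R : realType}.
Implicit Types (F : set R) (alpha : R).

Lemma lower_assouad_dimE F :
  lower_assouad_dim F = ereal_sup [set alpha%:E | alpha in lower_exponent F].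
Proof.
congr (ereal_sup _); apply/seteqP; split => _ [alpha [c [rho [c0 rho0 h]]] <-];
  exists alpha => //; exists c, rho; split => //.
  by move=> x r d Fx r0 rd drho; have /ereal_infP := h r d r0 rd drho; apply; exists x.
by move=> r d r0 rd drho; apply/ereal_infP => _ [x Fx <-]; exact: h.
Qed.

Lemma exponent_le_dim F alpha : lower_exponent F alpha -> (alpha%:E <= lower_assouad_dim F)%E.
Proof. by move=> h; rewrite lower_assouad_dimE; apply: ereal_sup_ubound; exists alpha. Qed.

Lemma dim_le F (b : \bar R) :
  (forall alpha, lower_exponent F alpha -> (alpha%:E <= b)%E) -> (lower_assouad_dim F <= b)%E.
Proof. by move=> h; rewrite lower_assouad_dimE; apply/ereal_supP => _ [alpha /h ? <-]. Qed.

Lemma lt_dim_exponent F (x : R) : (x%:E < lower_assouad_dim F)%E ->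
  exists2 alpha, x < alpha & lower_exponent F alpha.
Proof.
by rewrite lower_assouad_dimE => /ereal_sup_gt[_ [alpha ? <-]]; rewrite lte_fin; exists alpha.
Qed.

Lemma exponent_le0 F alpha : alpha <= 0 -> lower_exponent F alpha.
Proof.
move=> al0; exists 1, 1; split => // x r d Fx r0 rd _.
have d0 := lt_trans r0 rd.
apply: le_trans (covering_number_ge1 r0 (conj _ Fx)); last first.
  by rewrite closed_ballE// /closed_ball_ /= subrr normr0 ltW.
rewrite lee_fin mul1r -(powRr0 (d / r)); apply: ler_powR al0.
by rewrite ler_pdivlMr// mul1r ltW.
Qed.

Lemma dim_ge0 F : (0 <= lower_assouad_dim F)%E.
Proof. exact: exponent_le_dim (exponent_le0 _ (lexx 0)). Qed.

End Exponents.

(** * The dyadic means *)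

(** No element of the sequence is counted twice. *)
Lemma sum_count_le (T : Type) m (P : 'I_m -> pred T) (S : seq T) :
  (forall i j x, P i x -> P j x -> i = j) ->
  (\sum_i count (P i) S <= size S)%N.
Proof.
move=> Pinj; elim: S => [|x S IH] /=; first by rewrite big1.
rewrite big_split /= -add1n; apply: leq_add => //.
have [[i0 Pi0]|none] := pselect (exists i, P i x); last first.
  by rewrite big1// => i _; have [Pi|//] := boolP (P i x); case: none; exists i.
rewrite (bigD1 i0) //= Pi0 big1 // => i ii0; apply/eqP; rewrite eqb0.
by apply: contra ii0 => Pi; apply/eqP; exact: Pinj Pi Pi0.
Qed.

Section Means.
Context {R : realType} (a : nat -> R).
Hypothesis a_gt0 : forall j, (1 <= j)%N -> 0 < a j.
Hypothesis a_decr : forall j, (1 <= j)%N -> a j.+1 <= a j.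
Hypothesis a_sum : gap_summable a.

Let a_ge0 j (j1 : (1 <= j)%N) : 0 <= a j := ltW (a_gt0 j1).
Local Notation s := (dyadic_mean a).
Let tail n := weight a (fun j => (2 ^ n <= j)%N).

Lemma gap_decr i j : (1 <= i)%N -> (i <= j)%N -> a j <= a i.
Proof.
move=> i1 /subnKC <-; elim: (j - i)%N => [|k IH]; first by rewrite addn0.
by rewrite addnS; apply: le_trans IH; apply: a_decr; rewrite addn_gt0 i1.
Qed.

Let pow_gt0 n : 0 < 2 ^+ n :> R.
Proof. exact: exprn_gt0. Qed.

Lemma mean_tail n : tail n = 2 ^+ n * s n.
Proof. by rewrite /dyadic_mean tail_weight// ?expn_gt0// mulVKf// lt0r_neq0. Qed.

Lemma tail_block n : tail n = \sum_(2 ^ n <= j < 2 ^ n.+1) a j + tail n.+1.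
Proof.
rewrite (@big_nat_widenl _ _ _ _ 1) ?expn_gt0//= -head_weight//.
have le2 : (2 ^ n <= 2 ^ n.+1)%N by rewrite leq_pexp2l.
apply: weight_disjointU => // j j1.
  by have [/(leq_trans le2)->//|lt] := leqP (2 ^ n.+1) j; rewrite andbT orbF.
by apply/negP => /=; lia.
Qed.

Lemma block_le n : \sum_(2 ^ n <= j < 2 ^ n.+1) a j <= 2 ^+ n * a (2 ^ n)%N.
Proof.
rewrite big_nat; apply: (@le_trans _ _ (\sum_(2 ^ n <= j < 2 ^ n.+1) a (2 ^ n)%N)).
  by rewrite [leRHS]big_nat; apply: ler_sum => j /andP[nj _]; apply: gap_decr; rewrite ?expn_gt0.
by rewrite sumr_const_nat expnS mul2n -addnn addnK -natrX mulr_natl.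
Qed.

Lemma block_ge n : 2 ^+ n * a (2 ^ n.+1)%N <= \sum_(2 ^ n <= j < 2 ^ n.+1) a j.
Proof.
rewrite big_nat; apply: (@le_trans _ _ (\sum_(2 ^ n <= j < 2 ^ n.+1) a (2 ^ n.+1)%N)).
  by rewrite sumr_const_nat expnS mul2n -addnn addnK -natrX mulr_natl.
rewrite [leLHS]big_nat; apply: ler_sum => j /andP[nj jn]; apply: gap_decr; last exact: ltnW.
by apply: leq_trans nj; rewrite expn_gt0.
Qed.

Lemma mean_gt0 n : 0 < s n.
Proof.
rewrite -(pmulr_rgt0 _ (pow_gt0 n)) -mean_tail tail_block ltr_pwDl ?weight_ge0//.
apply: lt_le_trans (block_ge n); rewrite mulr_gt0//; apply: a_gt0.
by rewrite expn_gt0.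
Qed.

Lemma gap_le_mean n : a (2 ^ n.+1)%N <= s n.
Proof.
rewrite -(ler_pM2l (pow_gt0 n)) -mean_tail tail_block; apply: le_trans (block_ge n) _.
by rewrite lerDl; exact: weight_ge0.
Qed.

Lemma length_head_tail n : total_length a = \sum_(1 <= j < 2 ^ n) a j + tail n.
Proof.
rewrite -weightT -(head_weight a_ge0 a_sum xpredT); apply: weight_disjointU => // j j1.
  by rewrite /=; lia.
by apply/negP => /=; lia.
Qed.

Context (beta : R).
Hypothesis beta_lt : beta < 2^-1.
Hypothesis mean_ratio : forall n, dyadic_mean a n.+1 <= beta * dyadic_mean a n.

(** The block from [2 ^ n] to [2 ^ n.+1] has [2 ^ n] gaps and, by the ratio bound,
    carries a fixed proportion of the tail. *)
Lemma gap_ge_mean n : (1 - 2 * beta) * s n <= a (2 ^ n)%N.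
Proof.
rewrite -(ler_pM2l (pow_gt0 n)); apply: le_trans (block_le n).
have := tail_block n; rewrite !mean_tail exprS; have := mean_ratio n.
by rewrite -(ler_pM2l (pow_gt0 n)); lra.
Qed.

Lemma gap_comparable M : 0 < M -> (forall n, s n <= M * s n.+1) ->
  forall j, (1 <= j)%N ->
    (1 - 2 * beta) / M * s (level j) <= a j <= (M + 1) * s (level j).
Proof.
move=> M0 hM j j1; have b0 : 0 < 1 - 2 * beta by move: beta_lt; lra.
have /andP[lo hi] := level_bounds j1; move: lo hi; set n := level j => lo hi.
have sn := mean_gt0 n; apply/andP; split.
  apply: le_trans (gap_decr j1 (ltnW hi)); apply: le_trans (gap_ge_mean n.+1).
  by rewrite -mulrA ler_pM2l// mulrC ler_pdivrMr// mulrC.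
apply: (@le_trans _ _ (a (2 ^ n)%N)); first by apply: gap_decr; rewrite ?expn_gt0.
case: n {lo hi} sn => [|n] sn; last by have := gap_le_mean n; have := hM n; lra.
have := tail_block 0; rewrite mean_tail expr0 mul1r big_nat1 => e.
by have := weight_ge0 a_ge0 a_sum (fun j => (2 ^ 1 <= j)%N); have := mulr_gt0 M0 sn; rewrite /tail in e; lra.
Qed.

(** A global cover of the set by about [2 ^ (n + k)] balls serves at once the
    balls around the [2 ^ n] left ends of the longest gaps. These balls are far
    apart, so no member of the cover is used twice and one of them meets at most
    [2 ^ k.+1] members. *)
Lemma exponent_slow_decay (F : set R) alpha : complementary_sets a F -> 0 <= alpha ->
  lower_exponent F alpha -> slow_decay s alpha.
Proof.
move=> [_ [u [trivU UI FE]]] al0 [c [rho [c0 rho0 hexp]]].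
have b0 : 0 < 1 - 2 * beta by move: beta_lt; lra.
have FP y : F y <-> 0 <= y <= total_length a /\ forall j, (1 <= j)%N -> ~~ (u j < y < u j + a j).
  rewrite FE; split=> [[/= yI yU]|[yI yU]].
    split=> [|j j1]; first by move: yI; rewrite in_itv.
    by apply/negP => yj; apply: yU; exists j => //=; rewrite in_itv.
  split; first by rewrite /= in_itv.
  by case=> j j1; rewrite /= in_itv/=; apply/negP/yU.
clear FE.
have inU j y : (1 <= j)%N -> u j < y < u j + a j -> 0 <= y <= total_length a.
  by move=> j1 yU; have := UI j j1 y; rewrite /= !in_itv/=; apply.
have u_ge0 j : (1 <= j)%N -> 0 <= u j.
  move=> j1; rewrite leNgt; apply/negP => uj0; have aj := a_gt0 j1.
  have [le|lt] := leP (u j + a j) 0.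
    by have := inU j (u j + a j / 2) j1; lra.
  by have := inU j (u j / 2) j1; lra.
have u_le j : (1 <= j)%N -> u j + a j <= total_length a.
  move=> j1; rewrite leNgt; apply/negP => uL; have aj := a_gt0 j1.
  have [le|lt] := leP (total_length a) (u j).
    by have := inU j (u j + a j / 2) j1; lra.
  by have := inU j ((total_length a + (u j + a j)) / 2) j1; lra.
have sep : forall i j, (1 <= i)%N -> (1 <= j)%N -> i != j ->
    u i + a i <= u j \/ u j + a j <= u i.
  move=> i j i1 j1 ij; apply/orP; rewrite leNgt [X in _ || X]leNgt -negb_and.
  apply: contra ij => /andP[ji ij]; apply/eqP; apply: (trivU i j i1 j1).
  have ai := a_gt0 i1; have aj := a_gt0 j1.
  exists ((Num.max (u i) (u j) + Num.min (u i + a i) (u j + a j)) / 2).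
  by split; rewrite /= in_itv/=; case: (leP (u i) (u j)) => ?; case: (leP (u i + a i) (u j + a j)) => ?;
    apply/andP; split; lra.
have Fu j : (1 <= j)%N -> F (u j).
  move=> j1; have aj := a_gt0 j1; apply/FP; split.
    by rewrite u_ge0//=; have := u_le j j1; lra.
  move=> i i1; have [->|ij] := eqVneq i j; first by rewrite ltxx.
  have ai := a_gt0 i1; have := sep i j i1 j1 ij.
  by apply: contraPN => /andP[h1 h2] [] ?; lra.
have cover m : exists2 S, (size S)%:R <= 2 * 2 ^+ m :> R &
    forall y, F y -> exists2 x, x \in S & `|x - y| <= s m.
  have len0 : 0 <= total_length a by rewrite -weightT weight_ge0.
  have [|||j|i j|S sizeS covS] := @gap_cover _ u a (s m) (index_iota 1 (2 ^ m)) 0 (total_length a).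
  - exact: mean_gt0.
  - exact: iota_uniq.
  - exact: len0.
  - by rewrite mem_index_iota => /andP[j1 _]; split; [exact: a_gt0|exact: u_ge0|exact: u_le].
  - by rewrite !mem_index_iota => /andP[i1 _] /andP[j1 _]; exact: sep.
  exists S.
    apply: le_trans sizeS _; rewrite subr0 {1}(length_head_tail m) addrAC subrr add0r mean_tail.
    rewrite mulfK ?lt0r_neq0 ?mean_gt0// size_iota subn1 prednK ?expn_gt0// natrX; lra.
  move=> y /FP[yI yU]; apply: covS => // j.
  by rewrite mem_index_iota => /andP[j1 _]; exact: yU.
(* Two balls of radius [dlt * s n] that meet the same smaller ball have centres at
   distance less than [4 * dlt * s n <= a (2 ^ n)]. *)
pose dlt := (1 - 2 * beta) / 4.
have dlt0 : 0 < dlt by rewrite divr_gt0.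
have local_bound n k : dlt * s n < rho -> s (n + k)%N < dlt * s n ->
    c * (dlt * s n / s (n + k)%N) `^ alpha <= 2 * 2 ^+ k.
  set d := dlt * s n; set r := s (n + k)%N => drho rd.
  have r0 : 0 < r := mean_gt0 _.
  have [S sizeS covS] := cover (n + k)%N.
  pose near_ball (i : 'I_(2 ^ n)) x := `[< exists z, [/\ F z, `|u i.+1 - z| <= d & `|x - z| <= r] >].
  have lower i : c * (d / r) `^ alpha <= (count (near_ball i) S)%:R.
    rewrite -lee_fin; apply: le_trans (hexp (u i.+1) r d (Fu i.+1 isT) r0 rd drho) _.
    rewrite -size_filter; apply: covering_number_le => // y [].
    rewrite closed_ballE ?(lt_trans r0)// /closed_ball_ /= => yd Fy.
    have [x xS xy] := covS y Fy; exists x => //; rewrite mem_filter xS andbT.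
    by apply/asboolP; exists y.
  have disj : (\sum_i count (near_ball i) S <= size S)%N.
    apply: sum_count_le => i j x /asboolP[z [_ iz xz]] /asboolP[z' [_ jz' xz']].
    apply/val_inj/eqP; apply: contraT => /= ij.
    have gap_ge (l : 'I_(2 ^ n)) : 4 * d <= a l.+1.
      apply: le_trans (gap_decr (ltn0Sn l) (ltn_ord l)).
      by rewrite /d /dlt; apply: le_trans (gap_ge_mean n); lra.
    have gi := gap_ge i; have gj := gap_ge j.
    move: iz xz jz' xz'; rewrite !ler_norml => /andP[? ?] /andP[? ?] /andP[? ?] /andP[? ?].
    by have [|le|le] := sep i.+1 j.+1 isT isT; [by rewrite eqSS|lra|lra].
  have : 2 ^+ n * (c * (d / r) `^ alpha) <= 2 ^+ n * (2 * 2 ^+ k).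
    have -> : 2 ^+ n * (2 * 2 ^+ k) = 2 * 2 ^+ (n + k) :> R by rewrite exprD; ring.
    apply: le_trans sizeS; apply: (@le_trans _ _ (\sum_i (count (near_ball i) S)%:R)).
      rewrite -natrX mulr_natl -[X in _ *+ X]card_ord -sumr_const.
      by apply: ler_sum => i _; exact: lower.
    by rewrite -natr_sum ler_nat.
  by rewrite ler_pM2l.
have [n0 hn0] : exists n0, dlt * s n0 < rho.
  have [|n0 h] := scale_vanish mean_gt0 beta_lt mean_ratio (e := rho / dlt / 2).
    by rewrite !divr_gt0.
  exists n0; rewrite mulrC -ltr_pdivlMr//; apply: le_lt_trans h _.
  by rewrite ltr_pdivrMr// ltr_pMr ?divr_gt0// ltr1n.
have decr := scale_decr mean_gt0 beta_lt mean_ratio.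
(* The factor [c / (c + 2)] is at most 1, for radii with [s (n + k) >= dlt * s n],
   and at most [c / 2], for the others. *)
pose c1 := c / (c + 2) * dlt `^ alpha.
have c10 : 0 < c1 by rewrite mulr_gt0 ?powR_gt0// divr_gt0// addr_gt0.
have ratio_gt0 n m : 0 < s n / s m by rewrite divr_gt0 ?mean_gt0.
have late n k : (n0 <= n)%N -> c1 * (s n / s (n + k)%N) `^ alpha <= 2 ^+ k.
  move=> n0n; rewrite /c1 -mulrA -powRM ?(ltW dlt0) ?(ltW (ratio_gt0 _ _))// mulrA.
  have pk : 1 <= 2 ^+ k :> R by rewrite exprn_ege1// ler1n.
  rewrite mulrAC ler_pdivrMr ?addr_gt0//.
  have [rd|dr] := ltP (s (n + k)%N) (dlt * s n).
    have := local_bound n k _ rd; rewrite (le_lt_trans _ hn0) ?ler_pM2l ?decr// => /(_ isT).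
    by have := mulr_gt0 c0 (lt_le_trans ltr01 pk); lra.
  have : (dlt * s n / s (n + k)%N) `^ alpha <= 1.
    rewrite -(powRr0 (dlt * s n / s (n + k)%N)); apply: ger_powR => //.
    have sm := mean_gt0 (n + k); rewrite ler_pdivrMr// mul1r dr andbT.
    by rewrite divr_gt0// mulr_gt0// mean_gt0.
  rewrite -(ler_pM2l c0) => le1; apply: le_trans le1 _.
  have := ler_pM (ltW c0) ler01 (lexx c) pk; nra.
(* The finitely many [n < n0] are compared with [n0] at the price of the factor [Q]. *)
pose Q := (s 0%N / s n0) `^ alpha.
have Q1 : 1 <= Q.
  rewrite /Q -(powRr0 (s 0%N / s n0)); apply: ler_powR => //.
  by rewrite ler_pdivlMr ?mean_gt0// mul1r decr.
have Q0 := lt_le_trans ltr01 Q1.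
exists (c1 / Q) => [|n k]; first by rewrite divr_gt0.
rewrite mulrAC ler_pdivrMr//; have [le|lt] := leqP n0 n.
  by apply: le_trans (late n k le) _; rewrite ler_peMr// exprn_ge0.
apply: (@le_trans _ _ (c1 * (s n0 / s (n0 + k)%N) `^ alpha * Q)).
  rewrite -mulrA ler_pM2l// -powRM ?(ltW (ratio_gt0 _ _))//.
  apply: (ge0_ler_powR al0); [by rewrite nnegrE ltW| |].
    by rewrite nnegrE (mulr_ge0 (ltW (ratio_gt0 _ _)) (ltW (ratio_gt0 _ _))).
  have -> : s n0 / s (n0 + k)%N * (s 0%N / s n0) = s 0%N / s (n0 + k)%N.
    by field; rewrite !lt0r_neq0 ?mean_gt0.
  rewrite ler_pM ?invr_ge0 ?(ltW (mean_gt0 _))// ?decr//.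
  by rewrite lef_pV2 ?posrE ?mean_gt0// decr// leq_add2r ltnW.
by rewrite ler_pM2r// late.
Qed.

End Means.

(** * The extreme and the intermediate dimensions *)

Section Isolated.
Context {R : realType} (a : nat -> R).
Hypothesis a_gt0 : forall j, (1 <= j)%N -> 0 < a j.
Hypothesis a_sum : gap_summable a.

Let a_ge0 j (j1 : (1 <= j)%N) : 0 <= a j := ltW (a_gt0 j1).
Let nkey (j : nat) : R := j%:R.
Let nkey_inj i j : (1 <= i)%N -> (1 <= j)%N -> nkey i = nkey j -> i = j.
Proof. by move=> _ _ /eqP; rewrite eqr_nat => /eqP. Qed.

(** The first gap starts at 0, so a small ball around 0 contains only 0 and is
    covered by one ball of any radius. *)
Lemma sorted_arrangement_dim : lower_assouad_dim (arrangement a nkey) = 0%E.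
Proof.
apply/le_anti/andP; split; last exact: dim_ge0.
apply: dim_le => al [c [rho [c0 rho0 h]]]; rewrite lee_fin leNgt; apply/negP => al0.
have a1 : 0 < a 1%N := a_gt0 (leqnn 1).
pose d := Num.min rho (a 1%N) / 2.
have d0 : 0 < d by rewrite divr_gt0// lt_min rho0 a1.
have [drho da] : d < rho /\ d < a 1%N.
  by rewrite /d; case: (leP rho (a 1%N)) => ?; split; lra.
have u1 : gap_left a nkey 1 = 0.
  apply/le_anti/andP; split; last exact: weight_ge0.
  apply: weight_le => // n; rewrite big_nat_cond big1// => j /andP[/andP[j1 _]].
  by rewrite /nkey ltr_nat ltnNge j1.
(* At ratio [K] of the radii the exponent would demand [c * K ^ al >= 2] balls. *)
pose K := (2 / c) `^ al^-1 + 2.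
have iK : 0 <= (2 / c) `^ al^-1 by rewrite powR_ge0.
have K1 : 1 < K by rewrite /K; lra.
have K0 : 0 < K := lt_trans ltr01 K1.
have := h 0 (d / K) d (@arrangement0 R a nkey a_gt0 a_sum).
rewrite divr_gt0// ltr_pdivrMr// ltr_pMr// K1 drho.
move=> /(_ isT isT isT) /le_trans /(_ (covering_number_le (s := [:: 0]) _ _)).
rewrite (_ : d / (d / K) = K); last by field; rewrite !lt0r_neq0.
rewrite divr_gt0// lee_fin => /(_ isT) hc.
have : 2 / c <= K `^ al.
  rewrite -(@powR_rootK _ (2 / c) al) ?lt0r_neq0 ?divr_ge0 ?(ltW c0)//.
  apply: (ge0_ler_powR (ltW al0)); [by rewrite nnegrE|by rewrite nnegrE ltW|].
  by rewrite /K lerDl.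
rewrite ler_pdivrMr// mulrC; suff : c * K `^ al <= 1 by lra.
apply: hc => y [/=]; rewrite closed_ballE// /closed_ball_ /= => yd Ey.
exists 0; first by rewrite mem_head.
have [/andP[y0 _] yU] := (arrangementP a nkey y).1 Ey.
have : y <= 0.
  by move: yd (yU 1%N isT); rewrite u1 !add0r normrN ger0_norm// => ? /orP[|] //; lra.
move=> y0'; have -> : y = 0 by lra.
by rewrite subrr normr0 divr_ge0 ?(ltW d0) ?(ltW K0).
Qed.

End Isolated.

Section Matching.
Context {R : realType} (a : nat -> R).
Hypothesis a_gt0 : forall j, (1 <= j)%N -> 0 < a j.
Hypothesis a_decr : forall j, (1 <= j)%N -> a j.+1 <= a j.
Hypothesis a_sum : gap_summable a.
Context (beta : R).
Hypothesis beta_lt : beta < 2^-1.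
Hypothesis mean_ratio : forall n, dyadic_mean a n.+1 <= beta * dyadic_mean a n.
Local Notation s := (dyadic_mean a).

Let a_ge0 j (j1 : (1 <= j)%N) : 0 <= a j := ltW (a_gt0 j1).
Let s_gt0 : forall n, 0 < s n := mean_gt0 a_gt0 a_decr a_sum.
Let gap_beta : 0 < 1 - 2 * beta.
Proof. by move: beta_lt; lra. Qed.

Lemma cantor_exponent alpha : 0 < alpha -> slow_decay s alpha ->
  lower_exponent (cantor_set a) alpha.
Proof.
move=> al0 slow; have [M M0 dbl] := slow_decay_doubling s_gt0 al0 slow.
have cmp := gap_comparable a_gt0 a_decr a_sum beta_lt mean_ratio M0 dbl.
rewrite cantor_set_arrangement//.
have kinj i j : (1 <= i)%N -> (1 <= j)%N -> heap_key R i = heap_key R j -> i = j.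
  by move=> _ _; exact: heap_key_inj.
have [|||||||||c [rho [c0 rho0 h]]] := @part_lower_bound R a (heap_key R) a_gt0 a_sum kinj
  xpredT id 0 s ((1 - 2 * beta) / M) (M + 1) beta _ _ _ _ _ _ _ _ beta_lt _ alpha al0 slow => //.
- by move=> j _ _; rewrite add0r.
- by move=> j j1 _; have /andP[] := cmp j j1.
- move=> l l2 _; exists l; split => //; first exact: ltnW.
  by have /andP[] := cmp l (ltnW l2).
- exact: divr_gt0.
- by rewrite addr_gt0.
by exists c, rho; split => // y r d Ey r0 rd drho; apply: h.
Qed.

Context (x alpha : R).
Hypothesis x_gt0 : 0 < x.
Hypothesis x_le : x <= alpha.
Hypothesis slow : slow_decay s alpha.

Let alpha_gt0 : 0 < alpha := lt_le_trans x_gt0 x_le.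
Let sg := 2 `^ x^-1 : R.
Let sg_gt0 : 0 < sg. Proof. exact: powR_gt0. Qed.
Let sg_x : sg `^ x = 2. Proof. by rewrite powR_rootK ?lt0r_neq0. Qed.
Let sg_ge1 : 1 <= sg.
Proof. by rewrite -(powRr0 2); apply: ler_powR; rewrite ?ler1n// invr_ge0 ltW. Qed.

(** Doubling provides a level whose scale is within a bounded factor of
    [delta / sg ^ i], where [sg ^ x = 2]. Slow decay with [alpha >= x] makes that
    level at least [i + 2] once [delta] is small enough. *)
Lemma matching_levels : exists2 delta, 0 < delta &
  exists2 M, 0 < M /\ (forall n, s n <= M * s n.+1) &
  exists phi : nat -> nat, forall i, [/\ (i.+2 <= phi i)%N,
    s (phi i) <= delta / sg ^+ i & delta / sg ^+ i <= M * s (phi i)].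
Proof.
have [M M0 dbl] := slow_decay_doubling s_gt0 alpha_gt0 slow.
have [c c0 hc] := slow.
(* [c * K ^ alpha >= 4] turns the lower bound [2 ^ i] into [2 ^ (i + 2)]. *)
pose K := (4 / c) `^ alpha^-1 + 1; have K1 : 1 < K by rewrite ltrDr powR_gt0 ?divr_gt0.
have K0 := lt_trans ltr01 K1.
have KA : 4 / c <= K `^ alpha.
  rewrite -(@powR_rootK _ (4 / c) alpha) ?lt0r_neq0 ?divr_ge0 ?(ltW c0)//.
  apply: (ge0_ler_powR (ltW alpha_gt0)); [by rewrite nnegrE powR_ge0|by rewrite nnegrE ltW|].
  by rewrite /K lerDl.
pose delta := s 0%N / K; have d0 : 0 < delta by rewrite divr_gt0.
exists delta => //; exists M => //.
suff h : forall i, exists n, [/\ (i.+2 <= n)%N, s n <= delta / sg ^+ i & delta / sg ^+ i <= M * s n].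
  by have [phi hphi] := choice h; exists phi.
move=> i; have ti0 : 0 < delta / sg ^+ i by rewrite divr_gt0 ?exprn_gt0.
have := scale_vanish s_gt0 beta_lt mean_ratio ti0 => ex; case: (ex_minnP ex) => n hn min_n.
exists n; split => //.
  have : c * (s 0%N / s (0 + n)%N) `^ alpha <= 2 ^+ n := hc _ _.
  have : K * sg ^+ i <= s 0%N / s n.
    rewrite ler_pdivlMr// mulrC; move: hn; rewrite ler_pdivlMr ?exprn_gt0// => hn.
    rewrite mulrCA -ler_pdivlMl//; apply: le_trans hn _.
    by rewrite /delta mulrC.
  have Ks : 0 <= K * sg ^+ i by rewrite mulr_ge0 ?exprn_ge0 ?(ltW K0) ?(ltW sg_gt0).
  move=> le1 le2; have : 2 ^+ i.+2 <= 2 ^+ n :> R.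
    apply: le_trans le2; apply: (@le_trans _ _ (c * (K * sg ^+ i) `^ alpha)); last first.
      rewrite ler_pM2l//; apply: (ge0_ler_powR (ltW alpha_gt0)) => //.
      by rewrite nnegrE; apply: le_trans le1.
    rewrite powRM ?exprn_ge0 ?(ltW K0) ?(ltW sg_gt0)// powR_exprn ?(ltW sg_gt0)//.
    have sga : 2 <= sg `^ alpha by rewrite -sg_x; apply: ler_powR.
    have : 2 ^+ i <= (sg `^ alpha) ^+ i by rewrite lerXn2r ?nnegrE// (le_trans _ sga).
    move: KA; rewrite ler_pdivrMr// mulrC mulrA !exprS mulrA -natrM => KA le.
    by apply: ler_pM => //; exact: exprn_ge0.
  by rewrite ler_eXn2l// ltr1n.
case: n hn min_n => [|n] hn min_n.
  move: hn; rewrite leNgt; case/negP; rewrite ltr_pdivrMr ?exprn_gt0//.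
  rewrite /delta ltr_pdivrMr// -mulrA ltr_pMr// (lt_le_trans K1)//.
  by rewrite ler_peMl ?(ltW K0)// exprn_ege1.
apply: le_trans (dbl n); apply/ltW; rewrite ltNge; apply/negP => /min_n.
by rewrite ltnn.
Qed.

End Matching.

(** The picked gaps form a binary tree: node [l] of depth [i] is the gap with
    offset [2 * l + 1] in level [phi i]. As the offset determines [l], two depths may
    share a level. *)
Section Sparse.
Context (phi : nat -> nat).
Hypothesis phi_ge : forall i, (i.+2 <= phi i)%N.

Definition sparse_gap (l : nat) : nat := (2 ^ phi (level l) + (2 * l + 1))%N.

Definition sparse_label (j : nat) : nat := ((j - 2 ^ level j)./2)%N.

Definition is_sparse : pred nat := fun j =>
  (0 < sparse_label j)%N && (sparse_gap (sparse_label j) == j).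

Lemma sparse_gap_level l : (0 < l)%N -> level (sparse_gap l) = phi (level l).
Proof.
move=> l0; apply: level_leaf; have /andP[_ lt] := level_bounds l0.
by apply: (@leq_trans (2 ^ (level l).+2)); [rewrite [in X in (_ <= X)%N]expnS; lia|rewrite leq_pexp2l].
Qed.

Lemma sparse_gapK l : (0 < l)%N -> sparse_label (sparse_gap l) = l.
Proof. by move=> l0; rewrite /sparse_label sparse_gap_level// /sparse_gap; lia. Qed.

Lemma sparse_gap_sparse l : (0 < l)%N -> is_sparse (sparse_gap l).
Proof. by move=> l0; rewrite /is_sparse sparse_gapK// l0 eqxx. Qed.

Lemma sparse_gap_ge1 l : (1 <= sparse_gap l)%N.
Proof. by rewrite /sparse_gap addn1 addnS. Qed.

Lemma sparse_gapE j : is_sparse j ->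
  exists2 l, (0 < l)%N & j = sparse_gap l.
Proof. by move=> /andP[l0 /eqP e]; exists (sparse_label j). Qed.

Lemma sparse_odd j : is_sparse j -> odd j.
Proof.
move=> /sparse_gapE[l _ ->]; rewrite /sparse_gap addnA addn1 /= oddD oddX oddM.
by have := phi_ge (level l); case: (phi _).
Qed.

End Sparse.

(** Tree keys lie between 1 and 2, so the shift by 1 puts all the other gaps to the
    right of the picked ones. *)
Definition mixed_key (R : realType) (phi : nat -> nat) (j : nat) : R :=
  if is_sparse phi j then heap_key R (sparse_label j) else 1 + heap_key R j.

Section MixedKey.
Context {R : realType} (phi : nat -> nat).
Let A := is_sparse phi.
Let key := mixed_key R phi.

Lemma mixed_key_sparse j : A j -> key j = heap_key R (sparse_label j).
Proof. by rewrite /key /mixed_key /A => ->. Qed.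

Lemma mixed_key_dense j : ~~ A j -> key j = 1 + heap_key R j.
Proof. by rewrite /key /mixed_key /A => /negbTE ->. Qed.

Lemma mixed_key_lt i j : (1 <= i)%N -> (1 <= j)%N -> A i -> ~~ A j -> key i < key j.
Proof.
move=> i1 j1 Ai nAj; rewrite mixed_key_sparse// mixed_key_dense//.
have /andP[_ k2] := heap_key_bounds R (proj1 (andP Ai)).
by have /andP[k1 _] := heap_key_bounds R j1; move: k1 k2; lra.
Qed.

Lemma sparse_label_inj i j : A i -> A j -> sparse_label i = sparse_label j -> i = j.
Proof. by move=> /andP[_ /eqP e] /andP[_ /eqP e'] ij; rewrite -e -e' ij. Qed.

Lemma mixed_key_inj i j : (1 <= i)%N -> (1 <= j)%N -> key i = key j -> i = j.
Proof.
move=> i1 j1; have [Ai|nAi] := boolP (A i); have [Aj|nAj] := boolP (A j).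
- by rewrite !mixed_key_sparse// => /heap_key_inj; exact: sparse_label_inj.
- by have := mixed_key_lt i1 j1 Ai nAj => /[swap] ->; rewrite ltxx.
- by have := mixed_key_lt j1 i1 Aj nAi => /[swap] ->; rewrite ltxx.
- by rewrite !mixed_key_dense// => /addrI /heap_key_inj.
Qed.

End MixedKey.

Section MixedArrangement.
Context {R : realType} (a : nat -> R).
Hypothesis a_gt0 : forall j, (1 <= j)%N -> 0 < a j.
Hypothesis a_decr : forall j, (1 <= j)%N -> a j.+1 <= a j.
Hypothesis a_sum : gap_summable a.
Context (beta : R).
Hypothesis beta_lt : beta < 2^-1.
Hypothesis mean_ratio : forall n, dyadic_mean a n.+1 <= beta * dyadic_mean a n.
Local Notation s := (dyadic_mean a).
Context (x alpha : R).
Hypothesis x_gt0 : 0 < x.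
Hypothesis x_le : x <= alpha.
Hypothesis slow : slow_decay s alpha.
Let sg := 2 `^ x^-1 : R.
Context (delta M : R) (phi : nat -> nat).
Hypothesis delta_gt0 : 0 < delta.
Hypothesis M_gt0 : 0 < M.
Hypothesis s_doubling : forall n, s n <= M * s n.+1.
Hypothesis phi_match : forall i, [/\ (i.+2 <= phi i)%N,
    s (phi i) <= delta / sg ^+ i & delta / sg ^+ i <= M * s (phi i)].

Let t i := delta / sg ^+ i.
Let A := is_sparse phi.
Let key := mixed_key R phi.
Local Notation u := (gap_left a key).
Local Notation E := (arrangement a key).

Let a_ge0 j (j1 : (1 <= j)%N) : 0 <= a j := ltW (a_gt0 j1).
Let s_gt0 : forall n, 0 < s n := mean_gt0 a_gt0 a_decr a_sum.
Let gap_beta : 0 < 1 - 2 * beta.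
Proof. by move: beta_lt; lra. Qed.
Let sg_gt0 : 0 < sg. Proof. exact: powR_gt0. Qed.
Let sg_x : sg `^ x = 2. Proof. by rewrite powR_rootK ?lt0r_neq0. Qed.
Let phi_ge i : (i.+2 <= phi i)%N. Proof. by have [] := phi_match i. Qed.
Let t_gt0 n : 0 < t n. Proof. by rewrite divr_gt0 ?exprn_gt0. Qed.
Let t_ratio n : t n.+1 <= beta * t n.
Proof.
rewrite /t exprS invfM mulrCA ler_pM2r; last exact: t_gt0.
exact: (slow_decay_ratio s_gt0 mean_ratio x_gt0 x_le slow).
Qed.

Let p := (1 - 2 * beta) / M.
Let q := M + 1.
Let p_gt0 : 0 < p. Proof. exact: divr_gt0. Qed.
Let q_gt0 : 0 < q. Proof. exact: addr_gt0. Qed.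
Let key_inj : forall i j, (1 <= i)%N -> (1 <= j)%N -> key i = key j -> i = j.
Proof. exact: mixed_key_inj. Qed.
Let cmp := gap_comparable a_gt0 a_decr a_sum beta_lt mean_ratio M_gt0 s_doubling.

Let sparse_le j : (1 <= j)%N -> A j -> a j <= q * t (level (sparse_label j)).
Proof.
move=> j1 /sparse_gapE[l l0 jE]; have /andP[_ le] := cmp j1.
apply: le_trans le _; rewrite ler_pM2l// jE sparse_gapK// sparse_gap_level//.
by have [] := phi_match (level l).
Qed.

Let sparse_ge l : (2 <= l)%N -> ~~ odd l ->
  exists j, [/\ (1 <= j)%N, A j, sparse_label j = l & p / M * t (level l) <= a j].
Proof.
move=> l2 _; have l0 : (0 < l)%N := ltnW l2.
have j1 := sparse_gap_ge1 phi l; exists (sparse_gap phi l); split => //.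
- exact: sparse_gap_sparse.
- exact: sparse_gapK.
have /andP[ge _] := cmp j1; apply: le_trans ge; rewrite sparse_gap_level//.
have [_ _ le] := phi_match (level l).
by rewrite -[X in X <= _]mulrA ler_pM2l// mulrC ler_pdivrMr// mulrC.
Qed.

(** The left part has scales [t], for which [x] is an exponent by construction; the
    right part has scales [s], for which even [alpha >= x] is one. *)
Lemma mixed_exponent : lower_exponent E x.
Proof.
have slow_t : slow_decay t x by exact: slow_decay_geometric.
have slow_s : slow_decay s x by exact: (slow_decay_mono s_gt0 beta_lt mean_ratio x_le slow).
have [||c1 [rho1 [c10 rho10 h1]]] := part_lower_bound a_gt0 a_sum key_inj
  (A := A) (label := @sparse_label) (base := 0) _ (fun i j _ _ => @sparse_label_inj phi i j) _
  sparse_le sparse_ge t_gt0 (divr_gt0 p_gt0 M_gt0) q_gt0 beta_lt t_ratio x_gt0 slow_t.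
- by move=> j _ /andP[].
- by move=> j _ Aj; rewrite add0r /key mixed_key_sparse.
have [|||||c2 [rho2 [c20 rho20 h2]]] := part_lower_bound a_gt0 a_sum key_inj
  (A := predC A) (label := id) (base := 1) (q := q) (p := p) _ _ _
  _ _ s_gt0 p_gt0 q_gt0 beta_lt mean_ratio x_gt0 slow_s.
- by move=> j j1 _.
- by [].
- by move=> j _ nAj; rewrite /key mixed_key_dense.
- by move=> j j1 _; have /andP[] := cmp j1.
- move=> l l2 el; exists l; split => //; first exact: ltnW.
    by apply: contra el; exact: sparse_odd.
  by have /andP[] := cmp (ltnW l2).
exists (Num.min c1 c2), (Num.min rho1 rho2); split; [by rewrite lt_min c10|by rewrite lt_min rho10|].
move=> y r d Ey r0 rd; rewrite lt_min => /andP[drho1 drho2].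
have P0 : 0 <= (d / r) `^ x by exact: powR_ge0.
have [[j0 [j01 Aj0 yj0]]|all_left] := pselect (exists j, [/\ (1 <= j)%N, A j & ~~ (u j + a j <= y)]).
  apply: le_trans (h1 y r d Ey _ r0 rd drho1).
    by rewrite lee_fin ler_wpM2r// ge_min lexx.
  move=> j w j1 w1 nAj Aw; rewrite [RHS]ltNge (ltW (mixed_key_lt w1 j1 Aw nAj)) /=.
  apply: contraNF yj0; apply: (cut_downward a_gt0 a_sum key_inj Ey) => //.
  exact: ltW (mixed_key_lt _ _ _ _).
apply: le_trans (h2 y r d Ey _ r0 rd drho2).
  by rewrite lee_fin ler_wpM2r// ge_min lexx orbT.
move=> j w j1 w1; rewrite /= negbK => Aj nAw; rewrite /key mixed_key_lt//.
by apply: contraT => nj; case: all_left; exists j.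
Qed.

Let W := weight a A.

(** The first [2 ^ m - 1] picked gaps leave [2 ^ m] pieces of the left part, of
    total length about [2 ^ m * t m]. *)
Lemma sparse_box_cover m : exists2 S : seq R,
  (size S)%:R <= (1 + q / (1 - 2 * beta)) * 2 ^+ m &
  forall y, E y -> y <= W -> exists2 z, z \in S & `|z - y| <= t m.
Proof.
have W0 : 0 <= W by exact: weight_ge0.
pose J := map (sparse_gap phi) (index_iota 1 (2 ^ m)).
have JP j : j \in J -> A j /\ (1 <= j)%N.
  move=> /mapP[l]; rewrite mem_index_iota => /andP[l1 _] ->.
  by split; [exact: sparse_gap_sparse|exact: sparse_gap_ge1].
have sizeJ : (size J).+1 = (2 ^ m)%N.
  by rewrite size_map size_iota subn1 prednK ?expn_gt0.
have rest : W - \sum_(j <- J) a j <= 2 ^+ m * (q / (1 - 2 * beta) * t m).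
  rewrite lerBlDl; apply: (@le_trans _ _ (\sum_(j <- J) weight a (pred1 j) +
      \sum_(v <- index_iota (2 ^ m) (2 ^ m.+1))
        weight a (fun j => A j && in_node R m v (sparse_label j)))).
    apply: le_trans (weightU a_ge0 a_sum (B := mem J) (Z := fun j => A j && (j \notin J)) _) _.
      by move=> j j1 Aj /=; rewrite Aj orbN.
    apply: lerD; first by apply: weight_cover => // j j1 jJ; apply/hasP; exists j => /=.
    apply: weight_cover => // j j1 /andP[Aj jJ].
    have l0 : (0 < sparse_label j)%N by case/andP: Aj.
    have ml : (m <= level (sparse_label j))%N.
      apply: trunc_log_max => //; rewrite leqNgt; apply: contra jJ => lt.
      case/andP: Aj => _ /eqP <-; apply: map_f; rewrite mem_index_iota l0 //.
    have [k lev] : exists k, level (sparse_label j) = (m + k)%N.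
      by exists (level (sparse_label j) - m)%N; rewrite subnKC.
    have := level_bounds l0; rewrite lev -addSn !expnD => /andP[lo hi].
    have k0 : (0 < 2 ^ k)%N by rewrite expn_gt0.
    have vm : (2 ^ m <= sparse_label j %/ 2 ^ k < 2 ^ m.+1)%N.
      by rewrite leq_divRL// ltn_divLR// lo.
    apply/hasP; exists (sparse_label j %/ 2 ^ k)%N; first by rewrite mem_index_iota.
    by rewrite /= Aj /= {2}(divn_eq (sparse_label j) (2 ^ k)) node_in_node ?ltn_mod.
  apply: lerD.
    by rewrite big_seq [leRHS]big_seq; apply: ler_sum => j /JP[_ j1]; rewrite weight1.
  rewrite big_seq; apply: (@le_trans _ _ (\sum_(v <- index_iota (2 ^ m) (2 ^ m.+1) |
      v \in index_iota (2 ^ m) (2 ^ m.+1)) q / (1 - 2 * beta) * t m)).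
    apply: ler_sum => v; rewrite mem_index_iota => vm.
    apply: (subtree_weight a_gt0 a_sum _ _ sparse_le t_gt0 q_gt0 beta_lt t_ratio vm).
      by move=> j _ /andP[].
    by move=> i j _ _; exact: sparse_label_inj.
  rewrite -big_seq sumr_const_nat expnS mul2n -addnn addnK.
  by rewrite -[leLHS]mulr_natl natrX.
have [|||j|i j|S sizeS covS] := @gap_cover _ u a (t m) J 0 W => //.
- rewrite map_inj_in_uniq ?iota_uniq// => l l'; rewrite !mem_index_iota => /andP[l1 _] /andP[l1' _].
  by move=> e; rewrite -(sparse_gapK phi_ge l1) e sparse_gapK.
- move=> /JP[Aj j1]; split; [exact: a_gt0|exact: gap_left_ge0|].
  rewrite (gap_right a_gt0 a_sum key_inj j1); apply: weight_mono => // i i1.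
  by apply: contraLR => nAi; rewrite -ltNge /key mixed_key_lt.
- by move=> /JP[_ i1] /JP[_ j1]; exact: gap_order.
exists S.
  apply: le_trans sizeS _; rewrite sizeJ subr0 natrX [leRHS]mulrDl mul1r lerD2l.
  by rewrite ler_pdivrMr//; apply: le_trans rest _; rewrite mulrCA mulrA.
move=> y Ey yW; have [/andP[y0 _] yU] := (arrangementP a key y).1 Ey.
apply: covS; first by rewrite y0.
by move=> j /JP[_ j1]; rewrite negb_and -!leNgt yU.
Qed.

(** Around 0 and at a fixed radius only the left part is visible, and it needs about
    [2 ^ m] balls of radius [t m], which is the power [- x] of that radius. *)
Lemma mixed_dim : lower_assouad_dim E = x%:E.
Proof.
apply/le_anti/andP; split; last exact: exponent_le_dim mixed_exponent.
apply: dim_le => gam [c [rho [c0 rho0 h]]]; rewrite lee_fin leNgt; apply/negP => xgam.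
have W0 : 0 < W.
  have A1 : A (sparse_gap phi 1) by exact: sparse_gap_sparse.
  have j1 := sparse_gap_ge1 phi 1; apply: lt_le_trans (a_gt0 j1) _.
  rewrite -(weight1 a_ge0 a_sum j1); apply: weight_mono => // j _ /eqP -> //.
pose d := Num.min rho W / 2.
have d0 : 0 < d by rewrite divr_gt0// lt_min rho0.
have [drho dW] : d < rho /\ d < W.
  by rewrite /d; case: (leP rho W) => ?; split; lra.
pose C := 1 + q / (1 - 2 * beta).
have C0 : 0 < C by rewrite addr_gt0// divr_gt0.
have bound m : t m < d -> c * (d / t m) `^ gam <= C * 2 ^+ m.
  move=> td; have [S sizeS covS] := sparse_box_cover m.
  apply: le_trans sizeS; rewrite -lee_fin.
  apply: le_trans (h 0 (t m) d (@arrangement0 R a key a_gt0 a_sum) (t_gt0 m) td drho) _.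
  apply: covering_number_le => // y []; rewrite closed_ballE// /closed_ball_ /= => yd Ey.
  apply: covS => //; move: yd; rewrite sub0r normrN => /(le_trans (ler_norm y)) yd.
  exact: le_trans yd (ltW dW).
have w1 : 1 < sg `^ gam / 2.
  have one_lt (b e : R) : 0 < e -> 1 < b -> 1 < b `^ e.
    move=> e0 b1; have <- : 1 `^ e = 1 :> R by rewrite powR1.
    apply: (gt0_ltr_powR e0); rewrite ?nnegrE//.
    exact: ltW (lt_trans ltr01 b1).
  have sg1 : 1 < sg by apply: one_lt; rewrite ?invr_gt0// ltr1n.
  rewrite ltr_pdivlMr// mul1r (_ : gam = x + (gam - x)); last by ring.
  rewrite powRD ?(lt0r_neq0 sg_gt0) ?implybT// sg_x ltr_pMr//.
  by apply: one_lt => //; rewrite subr_gt0.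
have [m1 hm1] := scale_vanish t_gt0 beta_lt t_ratio (divr_gt0 d0 (ltr0Sn R 1)).
pose K := c * (d / delta) `^ gam.
have K0 : 0 < K by rewrite mulr_gt0// powR_gt0// divr_gt0.
have [n hn] := expr_unbounded (C / K) w1.
have tm : t (m1 + n)%N < d.
  apply: le_lt_trans (scale_decr t_gt0 beta_lt t_ratio (leq_addr n m1)) _.
  by apply: le_lt_trans hm1 _; rewrite gtr_pMr// invf_lt1// ltr1n.
have := bound _ tm; apply/negP; rewrite -ltNge.
have -> : d / t (m1 + n)%N = d / delta * sg ^+ (m1 + n).
  by rewrite /t; field; rewrite !lt0r_neq0 ?exprn_gt0.
rewrite powRM ?(divr_ge0 (ltW d0) (ltW delta_gt0)) ?exprn_ge0 ?(ltW sg_gt0)//.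
rewrite powR_exprn ?(ltW sg_gt0)// mulrA -/K.
have : C / K < (sg `^ gam / 2) ^+ (m1 + n).
  apply: lt_le_trans hn _; have w0 := lt_trans ltr01 w1.
  by rewrite exprD ler_peMl ?exprn_ge0 ?exprn_ege1 ?(ltW w1) ?(ltW w0).
by rewrite exprMn exprVn ltr_pdivlMr ?exprn_gt0// mulrAC ltr_pdivrMr// [ltRHS]mulrC.
Qed.

End MixedArrangement.

(** * The set of dimensions *)

(** The supremum is a real number, being at least the first ratio and below 1/2. *)
Lemma mean_ratio_bound (R : realType) (a : nat -> R) :
  (forall n, 0 < dyadic_mean a n) ->
  (ereal_sup [set (dyadic_mean a j / dyadic_mean a j.-1)%:E
             | j in [set j | (1 <= j)%N]] < (2^-1)%:E)%E ->
  exists2 beta, beta < 2^-1 & forall n, dyadic_mean a n.+1 <= beta * dyadic_mean a n.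
Proof.
set S := ereal_sup _ => s0 ltS.
have ub n : ((dyadic_mean a n.+1 / dyadic_mean a n)%:E <= S)%E.
  by apply: ereal_sup_ubound; exists n.+1.
move: ltS ub; case: S => [beta| |] //= lt ub.
  by exists beta => [|n]; [rewrite -lte_fin|rewrite -ler_pdivrMr// -lee_fin].
by have := ub 0%N; rewrite leeNy_eq.
Qed.

Theorem corollary15 (R : realType) (a : nat -> R)
    (a_gt0 : forall j, (1 <= j)%N -> 0 < a j)
    (a_decr : forall j, (1 <= j)%N -> a j.+1 <= a j)
    (a_sum : gap_summable a)
    (a_ratio : (ereal_sup [set (dyadic_mean a j / dyadic_mean a j.-1)%:E
                          | j in [set j | (1 <= j)%N]] < (2^-1)%:E)%E) :
  [set lower_assouad_dim E | E in complementary_sets a] =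
  [set x : \bar R | (0 <= x <= lower_assouad_dim (cantor_set a))%E].
Proof.
have s_gt0 := mean_gt0 a_gt0 a_decr a_sum.
have [beta beta_lt mean_ratio] := mean_ratio_bound s_gt0 a_ratio.
have cantor_key i j : (1 <= i)%N -> (1 <= j)%N -> heap_key R i = heap_key R j -> i = j.
  by move=> _ _; exact: heap_key_inj.
apply/seteqP; split => [_ [E CE <-] /=|x /= /andP[x0 xC]].
  rewrite dim_ge0 /=; apply: dim_le => alpha expE.
  have [al0|al0] := leP alpha 0; first exact: exponent_le_dim (exponent_le0 _ al0).
  apply: exponent_le_dim; apply: (cantor_exponent a_gt0 a_decr a_sum beta_lt mean_ratio al0).
  exact: (exponent_slow_decay a_gt0 a_decr a_sum beta_lt mean_ratio CE (ltW al0) expE).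
move: xC; rewrite le_eqVlt => /orP[/eqP ->|xC].
  exists (cantor_set a) => //; rewrite cantor_set_arrangement//.
  exact: arrangement_complementary.
move: x0; rewrite le_eqVlt => /orP[/eqP <-|x0].
  exists (arrangement a (fun j => j%:R)); last exact: sorted_arrangement_dim.
  apply: arrangement_complementary => // i j _ _ /eqP.
  by rewrite eqr_nat => /eqP.
move: x x0 xC => [x| |] //; rewrite ?lte_fin => x0 xC; last by rewrite ltNge leey in xC.
have [alpha xal expC] := lt_dim_exponent xC.
have CC : complementary_sets a (cantor_set a).
  by rewrite cantor_set_arrangement//; exact: arrangement_complementary.
have slow := exponent_slow_decay a_gt0 a_decr a_sum beta_lt mean_ratio CC
  (ltW (lt_trans x0 xal)) expC.
have [delta d0 [M [M0 dbl] [phi phiP]]] :=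
  matching_levels a_gt0 a_decr a_sum beta_lt mean_ratio x0 (ltW xal) slow.
exists (arrangement a (mixed_key R phi)); last first.
  exact: (mixed_dim a_gt0 a_decr a_sum beta_lt mean_ratio x0 (ltW xal) slow d0 M0 dbl phiP).
apply: arrangement_complementary => //.
exact: mixed_key_inj.
Qed.
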